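(* Let $\Omega\subset\mathbb{R}^d$ be open, and let $a,p,r$ be measurable functions on $\Omega$ with $a(x)\ge 0$ and $1\le p(x)\le r(x)<\infty$ for a.e. $x\in\Omega$. Assume that $a$ is essentially bounded on $\Omega$. Let $\Phi(x,t)=t^{p(x)}+a(x)t^{r(x)}$ for $x\in\Omega$, $t\ge 0$, and let $L^\Phi(\Omega)$ be the Musielak-Orlicz space generated by $\Phi$. Put $\Omega_1=\{x\in\Omega: a(x)\ne 0\}$. Suppose that at least one of the following holds: (i) $\operatorname{ess\,sup}_{x\in\Omega} r(x)<\infty$; (ii) $p(x)<r(x)$ for a.a. $x\in\Omega_1$, $\operatorname{ess\,sup}_{x\in\Omega}p(x)<\infty$, and $\operatorname{ess\,sup}_{x\in\Omega_1}r(x)<\infty$. Then $C_C^\infty(\Omega)$ is dense in $(L^\Phi(\Omega),\|\cdot\|_\Phi)$.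
   Context: $L^0(\Omega)$ is the set of all Lebesgue measurable complex-valued functions on $\Omega$ (functions equal a.e. are identified). For $f\in L^0(\Omega)$ put $I_\Phi(f)=\int_\Omega\Phi(x,|f(x)|)\,dx$. The Musielak-Orlicz space is $L^\Phi(\Omega)=\{f\in L^0(\Omega):\exists\lambda>0,\ I_\Phi(\lambda f)<\infty\}$, normed by $\|f\|_\Phi=\inf\{\lambda>0: I_\Phi(f/\lambda)\le 1\}$. $C_C^\infty(\Omega)$ is the set of infinitely differentiable complex-valued functions on $\Omega$ with compact support contained in $\Omega$. A function $\Phi:\Omega\times[0,\infty)\to[0,\infty)$ of the form $\Phi(x,t)=t^{p(x)}+a(x)t^{r(x)}$, where $a,p,r$ are measurable functions on $\Omega$ with $a(x)\ge 0$ and $1\le p(x)\le r(x)<\infty$ for a.e. $x\in\Omega$, is called a double phase functional. The density claim includes that $C_C^\infty(\Omega)\subset L^\Phi(\Omega)$. *)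

(* Defs.v *)
From HB Require Import structures.
From mathcomp Require Import all_boot all_order all_algebra.
From mathcomp Require Import complex.
From mathcomp Require Import all_classical all_reals all_analysis.

Set Implicit Arguments.
Unset Strict Implicit.
Unset Printing Implicit Defensive.
Import Order.TTheory GRing.Theory Num.Theory.
Import numFieldNormedType.Exports.

Local Open Scope classical_set_scope.
Local Open Scope ring_scope.

(** * Lebesgue measure on R^d

    The library has Lebesgue measure on [R] only.  Here it is the Carathéodory
    measure of the usual outer measure on ['rV[R]_d]: the infimum of the total
    volumes of countable covers by closed boxes.  The sigma-algebra of
    [caratheodory_type] is thus that of the Lebesgue (not just Borel)
    measurable sets. *)

Section lebesgue_outer_measure.
Context (R : realType) (d : nat).
Local Open Scope ereal_scope.

(* [Some (a, b)] is the closed box with corners [a] and [b], which is empty as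
   soon as [b i < a i] for some [i].  [None] is the empty set; it is needed
   only for [d = 0], where every box is the whole space and has volume 1. *)
Definition box : Type := option ('rV[R]_d * 'rV[R]_d).

Definition box_set (B : box) : set 'rV[R]_d :=
  if B is Some (a, b) then
    [set x | forall i, (a ord0 i <= x ord0 i <= b ord0 i)%R]
  else set0.

Definition box_vol (B : box) : \bar R :=
  if B is Some (a, b) then
    (\prod_(i < d) Num.max 0 (b ord0 i - a ord0 i))%R%:E
  else 0.

Definition box_cover (A : set 'rV[R]_d) : set (nat -> box) :=
  [set B | A `<=` \bigcup_k box_set (B k)].

Definition lebesgue_outer (A : set 'rV[R]_d) : \bar R :=
  ereal_inf [set \sum_(k <oo) box_vol (B k) | B in box_cover A].

Lemma box_vol_ge0 B : 0 <= box_vol B.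
Proof.
case: B => [[a b]|] //=; rewrite lee_fin.
by apply: prodr_ge0 => i _; rewrite le_max lexx.
Qed.

Lemma lebesgue_outer_ge0 A : 0 <= lebesgue_outer A.
Proof.
apply: le_ereal_inf_tmp => _ [B _ <-].
by apply: nneseries_ge0 => n _ _; exact: box_vol_ge0.
Qed.

Lemma lebesgue_outer0 : lebesgue_outer set0 = 0.
Proof.
apply/eqP; rewrite eq_le lebesgue_outer_ge0 andbT.
apply: ereal_inf_lbound; exists (fun=> None); first by move=> x [].
by rewrite eseries0//.
Qed.

Lemma le_lebesgue_outer :
  {homo lebesgue_outer : A B / A `<=` B >-> A <= B}.
Proof.
move=> A B AB; apply/ereal_inf_le_tmp => x [F cF <-].
by exists F => //; exact: subset_trans AB cF.
Qed.

Lemma lebesgue_outer_sigma_subadditive : sigma_subadditive lebesgue_outer.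
Proof.
move=> A; have [[i ioo]|] := pselect (exists i, lebesgue_outer (A i) = +oo).
  rewrite (eseries_pinfty _ _ ioo) ?leey// => n _.
  by rewrite -ltNye (lt_le_trans _ (lebesgue_outer_ge0 _)).
rewrite -forallNE => Aoo.
suff add2e (e : {posnum R}) : lebesgue_outer (\bigcup_n A n) <=
    \sum_(i <oo) lebesgue_outer (A i) + e%:num%:E.
  by apply/lee_addgt0Pr => _/posnumP[].
rewrite (le_trans _ (epsilon_trick _ _ _))//; last first.
  by move=> n; exact: lebesgue_outer_ge0.
pose P n (B : nat -> box) := box_cover (A n) B /\
  \sum_(k <oo) box_vol (B k) <=
    lebesgue_outer (A n) + (e%:num / (2 ^ n.+1)%:R)%:E.
have [G PG] : {G : nat -> nat -> box & forall n, P n (G n)}.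
  apply: (@choice _ _ P) => n; rewrite /P /lebesgue_outer.
  set S := (X in ereal_inf X); move infS : (ereal_inf S) => iS.
  case: iS infS => [r Sr|Soo|Soo].
  - have en1 : (0 < e%:num / (2 ^ n.+1)%:R)%R by [].
    have /(lb_ereal_inf_adherent en1) : ereal_inf S \is a fin_num by rewrite Sr.
    move=> [x [B AnB muBx] xS].
    by exists B; split => //; rewrite muBx -Sr; exact/ltW.
  - by have := Aoo n; rewrite /lebesgue_outer Soo.
  - have := lebesgue_outer_ge0 (A n).
    by rewrite /lebesgue_outer -/S Soo.
have vG_ge0 x : 0 <= (box_vol \o uncurry G) x by exact: box_vol_ge0.
apply: (@le_trans _ _ (\esum_(i in setT) (box_vol \o uncurry G) i)).
  apply: ereal_inf_lbound => /=.
  have /card_esym/ppcard_eqP[f] := card_nat2.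
  exists (uncurry G \o f).
    move=> t [i _] /((PG i).1) [j _ Gijt].
    by exists (f^-1%FUN (i, j)) => //=; rewrite invK ?inE.
  rewrite -(esum_pred_image (box_vol \o uncurry G) _ xpredT)
    ?[fun=> _]set_true//.
  by rewrite image_eq.
rewrite (_ : esum _ _ = \sum_(i <oo) \sum_(j <oo) box_vol (G i j)); last first.
  pose J : nat -> set (nat * nat) := fun i => [set (i, j) | j in setT].
  rewrite (_ : setT = \bigcup_k J k); last first.
    by rewrite predeqE => -[a b]; split => // _; exists a => //; exists b.
  rewrite esum_bigcupT /=; last 2 first.
    - apply/trivIsetP => i j _ _ ij.
      rewrite predeqE => -[n m] /=; split => //= -[] [_] _ [<-{n} _].
      by move=> [m' _] [] /esym/eqP; rewrite (negbTE ij).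
    - by move=> /= [n m]; exact: box_vol_ge0.
  rewrite -(image_id [set: nat]) -fun_true esum_pred_image//; last first.
    by move=> n _; apply: esum_ge0 => m _; exact: box_vol_ge0.
  apply: eq_eseriesr => /= j _.
  rewrite -(esum_pred_image (box_vol \o uncurry G) (pair j) predT)//=.
  - by congr esum; rewrite predeqE => -[a b]; split; move=> [i _ <-]; exists i.
  - by move=> n _; exact: box_vol_ge0.
  - by move=> ? ? _ _; exact: (@can_inj _ _ _ snd).
apply: lee_lim.
- apply: is_cvg_nneseries => n *.
  by apply: nneseries_ge0 => m *; exact: (vG_ge0 (n, m)).
- apply: is_cvg_nneseries => n *; apply: adde_ge0 => //.
  exact: lebesgue_outer_ge0.
- by near=> n; apply: lee_sum => i _; exact: (PG i).2.
Unshelve. all: by end_near. Qed.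

HB.instance Definition _ := isOuterMeasure.Build R 'rV[R]_d lebesgue_outer
  lebesgue_outer0 lebesgue_outer_ge0 le_lebesgue_outer
  lebesgue_outer_sigma_subadditive.

End lebesgue_outer_measure.

(* From here on [measurable A], for [A : set 'rV[R]_d], means that [A] is
   Lebesgue measurable. *)
HB.instance Definition _ (R : realType) (d : nat) :=
  Measurable.copy 'rV[R]_d (caratheodory_type (@lebesgue_outer R d)).

Definition lebesgue_rV (R : realType) (d : nat) : set 'rV[R]_d -> \bar R :=
  @lebesgue_outer R d.
Arguments lebesgue_rV : clear implicits.

HB.instance Definition _ (R : realType) (d : nat) :=
  isMeasure.Build _ 'rV[R]_d R (lebesgue_rV R d)
    (@caratheodory_measure0 R _ (@lebesgue_outer R d))
    (@caratheodory_measure_ge0 R _ (@lebesgue_outer R d))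
    (@caratheodory_measure_sigma_additive R _ (@lebesgue_outer R d)).

(* [ess_sup] relative to a domain [D] *)
Definition ess_sup_on (d : measure_display) (T : semiRingOfSetsType d)
    (R : realFieldType) (mu : set T -> \bar R) (D : set T)
    (f : T -> \bar R) : \bar R :=
  ereal_inf [set y | {ae mu, forall x, D x -> (f x <= y)%E}].

(** * Musielak-Orlicz spaces

    A function on [Omega] is a total function on ['rV[R]_d] of which only the
    values on [Omega] matter.  Functions equal almost everywhere are not
    identified: [MO_space] is the set of all representatives, and [MO_norm]
    does not depend on the representative. *)

Section Musielak_Orlicz.
Context (R : realType) (d : nat).
Variables (Omega : set 'rV[R]_d) (Phi : 'rV[R]_d -> R -> R).
Implicit Types f g : 'rV[R]_d -> R[i].

Definition cmeasurable_fun f : Prop :=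
  measurable_fun Omega (fun x => complex.Re (f x)) /\
  measurable_fun Omega (fun x => complex.Im (f x)).

(* [normc] is the modulus with values in [R] instead of [R[i]]. *)
Definition MO_modular f : \bar R :=
  (\int[lebesgue_rV R d]_(x in Omega)
     (Phi x (ComplexField.Normc.normc (f x)))%:E)%E.

Definition MO_space : set ('rV[R]_d -> R[i]) :=
  [set f | cmeasurable_fun f /\
    exists2 l : R, 0 < l & (MO_modular (fun x => l%:C%C * f x)%R < +oo)%E].

Definition MO_norm f : \bar R :=
  ereal_inf [set l%:E | l in
    [set l : R | 0 < l /\ (MO_modular (fun x => f x / l%:C%C)%R <= 1)%E]].

Definition MO_dense (D : set ('rV[R]_d -> R[i])) : Prop :=
  D `<=` MO_space /\
  forall f, MO_space f -> forall e : R, 0 < e ->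
    exists2 g, D g & (MO_norm (fun x => f x - g x)%R < e%:E)%E.

End Musielak_Orlicz.

Definition double_phase (R : realType) (T : Type) (a p r : T -> R)
    (x : T) (t : R) : R :=
  t `^ (p x) + a x * t `^ (r x).

Section test_functions.
Context (R : realType) (d : nat).
Implicit Types (Omega : set 'rV[R]_d) (u : 'rV[R]_d -> R).

(* [iter_partial [:: i1; ..; ik] u] is the k-th order partial derivative
   d/dx_i1 (.. (d/dx_ik u)). *)
Definition iter_partial (s : seq 'I_d) u : 'rV[R]_d -> R :=
  foldr (fun i v => fun x => 'D_(delta_mx ord0 i) v x) u s.

Definition smooth_on Omega u : Prop :=
  forall (s : seq 'I_d) x, Omega x ->
    {for x, continuous (iter_partial s u)} /\
    forall i, derivable (iter_partial s u) x (delta_mx ord0 i).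

Definition support_on Omega (f : 'rV[R]_d -> R[i]) : set 'rV[R]_d :=
  closure (Omega `&` [set x | f x != 0]).

Definition Cc_infty Omega : set ('rV[R]_d -> R[i]) :=
  [set f | [/\ smooth_on Omega (fun x => complex.Re (f x)),
               smooth_on Omega (fun x => complex.Im (f x)),
               compact (support_on Omega f) &
               support_on Omega f `<=` Omega]].

End test_functions.

(* Main.v *)
(* On the full-measure set [D] where the pointwise hypotheses hold, the
   exponents are bounded wherever they matter: outside [Omega1] the term
   [a x * t `^ r x] vanishes, so (ii) gives the same bounds as (i).  Hence [Phi]
   is doubling, so norm convergence is convergence of the modular at every
   scale, and [Phi x t <= C * t] for bounded [t], so the modular of a uniformly
   bounded function is controlled by the measure of a set carrying it.  By
   dominated convergence it is enough to approximate indicator functions of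
   measurable subsets of a finite union [U] of open boxes with closure in
   [Omega].  By definition of the outer measure such a set is, up to a set of
   small measure, the intersection of [U] with a countable union of open boxes
   (the faces are null), hence also with a finite one.  The indicator function
   of [0 < u], with [u] smooth, nonnegative and compactly supported, is the
   bounded pointwise limit of the smooth functions [n u / (1 + n u)], and such
   [u] are obtained from products of [exp (- 1 / t)]. *)

Require Import Defs.
From mathcomp Require Import all_boot all_order all_algebra.
From mathcomp Require Import complex.
From mathcomp Require Import all_classical all_reals all_analysis.
From mathcomp Require Import measurable_realfun ring lra.

Set Implicit Arguments.
Unset Strict Implicit.
Unset Printing Implicit Defensive.
Import Order.TTheory GRing.Theory Num.Theory.
Import numFieldNormedType.Exports.
Local Open Scope classical_set_scope.
Local Open Scope ring_scope.

(** * Smooth functions *)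

(** The function t^(-n) exp(-1/t), extended by 0 to t <= 0. The power [n] is a parameter so that the
    family is closed under differentiation up to linear combinations. *)
Definition flat (R : realType) (n : nat) (t : R) : R :=
  if 0 < t then t^-1 ^+ n * expR (- t^-1) else 0.

Lemma flat_gt0 (R : realType) n (t : R) : (0 < flat n t) = (0 < t).
Proof.
rewrite /flat; case: ifPn => t0; last by rewrite ltxx.
by rewrite mulr_gt0 ?expR_gt0// exprn_gt0// invr_gt0.
Qed.

Lemma flat_ge0 (R : realType) n (t : R) : 0 <= flat n t.
Proof.
have [t0|t0] := ltP 0 t; first by rewrite ltW// flat_gt0.
by rewrite /flat ltNge t0.
Qed.

(** A single term of the exponential series suffices: exp(s) >= s^(n+2) / (n+2)! at s = 1/t. The
    quadratic bound makes the difference quotient at 0 of size at most (n+2)! |h|, so the derivative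
    there is 0. *)
Lemma flat_le (R : realType) n (t : R) : flat n t <= (n.+2)`!%:R * t ^+ 2.
Proof.
rewrite /flat; case: ifPn => t0; last by rewrite mulr_ge0// sqr_ge0.
have := @expR_ge1Dxn R t^-1 n.+1 (ltW _).
rewrite invr_gt0 t0 => /(_ isT) h.
have {}h : t^-1 ^+ n.+2 / n.+2`!%:R <= expR t^-1 by apply: le_trans h; rewrite lerDr.
rewrite expRN ler_pdivrMr ?expR_gt0//.
have f0 : 0 < n.+2`!%:R :> R by rewrite ltr0n fact_gt0.
have : t^-1 ^+ n.+2 <= n.+2`!%:R * expR t^-1 by rewrite mulrC -ler_pdivrMr.
move=> /(ler_wpM2r (sqr_ge0 t)).
by rewrite -addn2 exprD -mulrA -exprMn mulVf ?gt_eqF// expr1n mulr1 mulrAC.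
Qed.

Lemma is_derive_flat (R : realType) n (t : R) :
  is_derive t 1 (flat n) (flat n.+2 t - n%:R * flat n.+1 t).
Proof.
have [t0|t0|->] := ltgtP t 0.
- have nf m : flat m t = 0 by rewrite /flat ltNge ltW.
  rewrite !nf mulr0 subr0.
  apply: (@near_eq_is_derive _ _ _ (cst 0)).
  near=> y; rewrite /flat ifF//; apply/negbTE; rewrite -leNgt ltW//; near: y.
  exact: lt_nbhsl.
- have -> : flat n.+2 t - n%:R * flat n.+1 t =
    t^-1 ^+ n.+2 * expR (- t^-1) - n%:R * (t^-1 ^+ n.+1 * expR (- t^-1)).
    by rewrite /flat t0.
  have t0' : t != 0 by rewrite gt_eqF.
  have dV : is_derive t 1 (@GRing.inv R) (- t ^- 2 *: 1).
    by apply: is_deriveV.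
  have dN := is_deriveN dV.
  have dE := @is_derive1_comp R (@expR R) (fun y => - y^-1) t _ _ (is_derive_expR _) dN.
  have dM := is_deriveM (is_deriveX n dV) dE.
  apply: near_eq_is_derive (is_derive_eq dM _).
    near=> y; rewrite /flat ifT; last by near: y; exact: lt_nbhsr.
    by rewrite fctE exprfctE.
  rewrite exprfctE/= /GRing.scale/= mulr1.
  case: n {dM} => [|n]; rewrite ?expr0 ?mul0r/= ?exprS; field => //.
- have nf m : flat m 0 = 0 by rewrite /flat ltxx.
  rewrite !nf mulr0 subr0.
  pose C : R := n.+2`!%:R.
  have C0 : 0 < C by rewrite ltr0n fact_gt0.
  have lim0 : (fun h => h^-1 *: ((flat n \o shift 0) (h *: (1:R)) - flat n 0))
      @ 0^' --> (0 : R).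
    apply/cvgr0Pnorm_le => e e0.
    near=> h.
    have h0 : h != 0 by near: h; exact: nbhs_dnbhs_neq.
    rewrite /= nf subr0 addr0 /GRing.scale/= mulr1 normrM normfV.
    rewrite (ger0_norm (flat_ge0 _ _)) ler_pdivrMl ?normr_gt0//.
    apply: le_trans (flat_le _ _) _.
    rewrite -real_normK ?num_real// expr2 mulrCA ler_wpM2l//.
    rewrite mulrC -ler_pdivlMr//; near: h.
    by apply: dnbhs0_le; rewrite divr_gt0.
  apply: DeriveDef; first by apply/cvg_ex; exists 0.
  exact: cvg_lim lim0.
Unshelve. all: by end_near. Qed.
(* A class of functions that is closed under partial derivatives by
   construction, yet contains enough bump functions. *)
Inductive elementary (R : realType) (d : nat) : ('rV[R]_d -> R) -> Prop :=
| elementary_cst c : elementary (fun=> c)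
| elementary_flat n i a b :
    elementary (fun x => flat n (a * x ord0 i + b))
| elementary_add u v : elementary u -> elementary v ->
    elementary (fun x => u x + v x)
| elementary_mul u v : elementary u -> elementary v ->
    elementary (fun x => u x * v x)
| elementary_inv u : elementary u -> (forall x, 0 < u x) ->
    elementary (fun x => (u x)^-1).

Lemma is_derive_coord (R : realType) d (i : 'I_d) (x v : 'rV[R]_d) :
  is_derive x v (fun y : 'rV[R]_d => y ord0 i) (v ord0 i).
Proof.
have dx := @differentiable_coord R 1 d x ord0 i.
apply: DeriveDef; first exact: diff_derivable.
apply: cvg_lim => //; apply: cvg_near_cst; near=> h.
by rewrite /= !mxE addrK /GRing.scale/= mulKf//; near: h; exact: nbhs_dnbhs_neq.
Unshelve. all: by end_near. Qed.

(** Full differentiability is carried through the induction next to the partial derivatives, since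
    partial derivatives alone would give neither continuity nor the chain rule. *)
Lemma elementary_derive (R : realType) d (u : 'rV[R]_d -> R) : elementary u ->
  (forall x, differentiable u x) /\
  forall i, exists2 u', elementary u' &
    forall x, is_derive x (delta_mx ord0 i) u (u' x).
Proof.
elim=> {u}.
- move=> c; split=> [x|i]; first exact: differentiable_cst.
  by exists (fun=> 0); [exact: elementary_cst|move=> x; exact: is_derive_cst].
- move=> n i a b.
  have daf x v : is_derive x v (fun y : 'rV[R]_d => a * y ord0 i + b) (a * v ord0 i).
    have D := is_deriveD (is_deriveZ a (is_derive_coord i x v)) (is_derive_cst b x v).
    by apply: is_derive_eq D _; rewrite addr0.
  have faf x : differentiable (fun y : 'rV[R]_d => a * y ord0 i + b) x.
    apply: differentiableD; last exact: differentiable_cst.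
    by apply: differentiableM => //; exact: differentiable_coord.
  have dfl (t : R) : differentiable (flat n) t.
    by apply/derivable1_diffP; have [] := is_derive_flat n t.
  have dc x : differentiable (fun y : 'rV[R]_d => flat n (a * y ord0 i + b)) x.
    exact: differentiable_comp (faf x) (dfl _).
  split=> // j.
  pose dl := (delta_mx ord0 j : 'rV[R]_d).
  (* The derivative is written with sums, products and constants only, so that the constructors of
     [elementary] apply; subtraction becomes a factor [- n%:R]. *)
  exists (fun x => (a * dl ord0 i) * (flat n.+2 (a * x ord0 i + b) +
      (- n%:R) * flat n.+1 (a * x ord0 i + b))).
    apply: elementary_mul; first exact: elementary_cst.
    apply: elementary_add; first exact: elementary_flat.
    by apply: elementary_mul; [exact: elementary_cst|exact: elementary_flat].
  move=> x; apply: DeriveDef; first exact: diff_derivable.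
  (* The chain rule holds for differentials; the result is converted back to directional
     derivatives. *)
  rewrite deriveE// (@diff_comp _ _ _ _ _ (flat n) x (faf x) (dfl _))/=.
  rewrite diff1E// derive1E -deriveE//.
  have [_ ->] := daf x dl; have [_ ->] := is_derive_flat n (a * x ord0 i + b).
  by rewrite mulNr.
- move=> u v eu [du Du] ev [dv Dv]; split=> [x|i]; first exact: differentiableD.
  have [u' eu' Du'] := Du i; have [v' ev' Dv'] := Dv i.
  exists (fun x => u' x + v' x); first exact: elementary_add.
  by move=> x; exact: is_deriveD.
- move=> u v eu [du Du] ev [dv Dv]; split=> [x|i]; first exact: differentiableM.
  have [u' eu' Du'] := Du i; have [v' ev' Dv'] := Dv i.
  exists (fun x => u x * v' x + v x * u' x).
    by apply: elementary_add; exact: elementary_mul.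
  by move=> x; exact: is_deriveM.
- move=> u eu [du Du] u0; split=> [x|i].
    by apply: differentiableV => //; rewrite gt_eqF.
  have [u' eu' Du'] := Du i.
  have eV := elementary_inv eu u0.
  exists (fun x => (-1) * ((u x)^-1 * (u x)^-1) * u' x).
    do 2 (apply: elementary_mul => //); first exact: elementary_cst.
    exact: elementary_mul.
  move=> x; have [dx <-] := Du' x; have ux : u x != 0 by rewrite gt_eqF.
  apply: DeriveDef; first exact: derivableV.
  by rewrite deriveV// /GRing.scale/= mulN1r expr2 invfM.
Qed.

Lemma elementary_smooth (R : realType) d (Omega : set 'rV[R]_d) u :
  elementary u -> smooth_on Omega u.
Proof.
move=> eu s x _.
have es : elementary (iter_partial s u).
  elim: s => //= i s es.
  have [_ /(_ i)[v ev Dv]] := elementary_derive es.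
  by rewrite (_ : (fun x => _) = v)//; apply/funext => y; have [] := Dv y.
have [des _] := elementary_derive es.
split; first exact: differentiable_continuous.
by move=> i; exact: diff_derivable.
Qed.

Lemma elementary_continuous (R : realType) d (u : 'rV[R]_d -> R) :
  elementary u -> continuous u.
Proof.
move=> /elementary_derive[du _] x; exact: differentiable_continuous.
Qed.

(** * Boxes and Lebesgue measure *)

(** Cutting along the hyperplane x_i = c changes only the i-th factor. If [c] misses the i-th side,
    one piece is degenerate and the truncation at 0 gives it volume zero. *)
Lemma box_vol_cut (R : realType) d (i : 'I_d) (c : R) (a b : 'rV[R]_d) :
  (box_vol (Some (a, \row_j if j == i then Num.min (b ord0 j) c else b ord0 j)) +
   box_vol (Some (\row_j (if j == i then Num.max (a ord0 j) c else a ord0 j), b)) =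
  box_vol (Some (a, b)))%E.
Proof.
rewrite /= -EFinD; congr EFin.
rewrite (bigD1 i)//= [in X in _ + X](bigD1 i)//= [in RHS](bigD1 i)//= !mxE eqxx.
set P := \prod_(j < d | j != i) Num.max 0 (b ord0 j - a ord0 j).
rewrite (eq_bigr (fun j => Num.max 0 (b ord0 j - a ord0 j))) => [|j ji]; last first.
  by rewrite mxE (negbTE ji).
rewrite [in X in _ + X](eq_bigr (fun j => Num.max 0 (b ord0 j - a ord0 j)));
  last first => [j ji|].
  by rewrite mxE (negbTE ji).
rewrite -/P -mulrDl; congr (_ * _).
rewrite /Order.max /Order.min; do ! case: ifPn; lra.
Qed.

(** Cutting every box of a cover of X along x_i = c yields covers of the parts of X inside and
    outside [H] with the same total volume. Both pieces are closed, so points of the hyperplane may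
    lie on either side; this treats open and closed half-spaces at once. *)
Lemma halfspace_measurable (R : realType) d (i : 'I_d) (c : R) (H : set 'rV[R]_d) :
  [set x : 'rV[R]_d | x ord0 i < c] `<=` H ->
  H `<=` [set x : 'rV[R]_d | x ord0 i <= c] ->
  measurable H.
Proof.
move=> ltH Hle; apply: le_caratheodory_measurable => X.
apply: le_ereal_inf_tmp => _ [B cB <-].
pose L (B : box R d) : box R d := if B is Some (a, b) then
  Some (a, \row_j if j == i then Num.min (b ord0 j) c else b ord0 j) else None.
pose U (B : box R d) : box R d := if B is Some (a, b) then
  Some (\row_j (if j == i then Num.max (a ord0 j) c else a ord0 j), b) else None.
have -> : (\sum_(k <oo) box_vol (B k) = 
    \sum_(k <oo) box_vol (L (B k)) + \sum_(k <oo) box_vol (U (B k)))%E.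
  rewrite -nneseriesD//; [|by move=> k _ _; exact: box_vol_ge0..].
  apply: eq_eseriesr => k _; case: (B k) => [[a b]|]; last by rewrite adde0.
  exact/esym/box_vol_cut.
apply: leeD; apply: ereal_inf_lbound.
  exists (fun k => L (B k)) => //= x [/cB[k _ Bk] Hx]; exists k => //.
  case: (B k) Bk => [[a b]|]//= h j; rewrite mxE; have /andP[h1 h2] := h j.
  by rewrite h1/=; case: eqVneq => // ->; rewrite le_min (Hle _ Hx) (andP (h i)).2.
exists (fun k => U (B k)) => //= x [/cB[k _ Bk] Hx]; exists k => //.
case: (B k) Bk => [[a b]|]//= h j; rewrite mxE; have /andP[h1 h2] := h j.
rewrite h2 andbT; case: eqVneq => // ->; rewrite ge_max (andP (h i)).1/=.
by rewrite leNgt; apply/negP => /ltH.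
Qed.

Definition open_box (R : realType) d (B : box R d) : set 'rV[R]_d :=
  if B is Some (a, b) then
    [set x : 'rV[R]_d | forall i, a ord0 i < x ord0 i < b ord0 i] else set0.

Lemma measurable_forall_ord (R : realType) d (P : 'I_d -> set 'rV[R]_d) :
  (forall i, measurable (P i)) -> measurable [set x | forall i, P i x].
Proof.
move=> mP; rewrite (_ : mkset _ = \bigcap_(i in [set: 'I_d]) P i).
  by apply: fin_bigcap_measurable => //; exact: finite_finset.
by apply/seteqP; split => x /= h i => [_|]; exact: h.
Qed.

Lemma measurable_coord_lt (R : realType) d (i : 'I_d) (c : R) :
  measurable [set x : 'rV[R]_d | x ord0 i < c].
Proof. by apply: (@halfspace_measurable _ _ i c) => //= x /ltW. Qed.

Lemma measurable_coord_gt (R : realType) d (i : 'I_d) (c : R) :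
  measurable [set x : 'rV[R]_d | c < x ord0 i].
Proof.
rewrite (_ : mkset _ = ~` [set x : 'rV[R]_d | x ord0 i <= c]).
  apply: measurableC; apply: (@halfspace_measurable _ _ i c) => //= x.
  exact: ltW.
by apply/seteqP; split => x /=; rewrite ltNge => /negP.
Qed.

Lemma open_box_measurable (R : realType) d (B : box R d) : measurable (open_box B).
Proof.
case: B => [[a b]|]/=; last exact: measurable0.
apply: measurable_forall_ord => i.
rewrite (_ : (fun x => _) = [set x : 'rV[R]_d | a ord0 i < x ord0 i] `&`
    [set x : 'rV[R]_d | x ord0 i < b ord0 i]).
  by apply: measurableI; [exact: measurable_coord_gt|exact: measurable_coord_lt].
by apply/seteqP; split => x /= /andP.
Qed.

Lemma box_set_compact (R : realType) d (B : box R d) : compact (box_set B).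
Proof.
case: B => [[a b]|]/=; last exact: compact0.
have := @rV_compact R d (fun i => [set` `[a ord0 i, b ord0 i]])
  (fun i => @segment_compact _ _ _).
by congr compact; apply/seteqP; split => x /= h i; have := h i; rewrite in_itv.
Qed.

Lemma open_box_sub (R : realType) d (B : box R d) : open_box B `<=` box_set B.
Proof. by case: B => [[a b]|]//= x h i; have /andP[/ltW-> /ltW->] := h i. Qed.

(** * Rational boxes and measurability of open sets *)

Lemma rational_box_between (R : realType) d (Omega : set 'rV[R]_d) x :
  open Omega -> Omega x ->
  exists q : 'rV[rat]_d * 'rV[rat]_d,
    let B := Some (map_mx ratr q.1, map_mx ratr q.2) in
    open_box B x /\ box_set B `<=` Omega.
Proof.
move=> oO Ox; have /nbhs_ballP[e /= e0 be] := open_nbhs_nbhs (conj oO Ox).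
have lo i : exists q : rat, x ord0 i - e < ratr q < x ord0 i.
  have [|q] := @rat_in_itvoo R (x ord0 i - e) (x ord0 i); first by rewrite ltrBlDr ltrDl.
  by rewrite in_itv /=; exists q.
have hi i : exists q : rat, x ord0 i < ratr q < x ord0 i + e.
  have [|q] := @rat_in_itvoo R (x ord0 i) (x ord0 i + e); first by rewrite ltrDl.
  by rewrite in_itv /=; exists q.
have [l Hl] := choice lo; have [u Hu] := choice hi.
exists (\row_i l i, \row_i u i) => /=; split=> [i|y Hy].
  by rewrite !mxE (andP (Hl i)).2 (andP (Hu i)).1.
apply: be; split=> // i j; rewrite (ord1 i) -ball_normE/=.
have := Hy j; rewrite !mxE => /andP[h1 h2].
have /andP[] := Hl j; have /andP[] := Hu j => *; rewrite ltr_norml; lra.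
Qed.

(** An enumeration of the closed rational boxes inside [Omega], by decoding [k]. Codes of no box, or
    of a box that leaves [Omega], give the empty box. *)
Definition rational_box (R : realType) d (Omega : set 'rV[R]_d) (k : nat) :
    box R d :=
  if @unpickle ('rV[rat]_d * 'rV[rat]_d)%type k is Some q then
    let B := Some (map_mx ratr q.1, map_mx ratr q.2) in
    if `[< box_set B `<=` Omega >] then B else None
  else None.

Lemma rational_box_sub (R : realType) d (Omega : set 'rV[R]_d) k :
  box_set (rational_box Omega k) `<=` Omega.
Proof.
by rewrite /rational_box; case: unpickle => [q|x []//]; case: asboolP => // _ x [].
Qed.

Lemma bigcup_rational_box (R : realType) d (Omega : set 'rV[R]_d) :
  open Omega -> Omega = \bigcup_k open_box (rational_box Omega k).
Proof.
move=> oO; apply/seteqP; split => [x Ox|x [k _ /open_box_sub]]; last first.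
  exact: rational_box_sub.
have [q [qx qO]] := rational_box_between oO Ox.
by exists (pickle q) => //; rewrite /rational_box pickleK ifT//; exact/asboolP.
Qed.

Lemma open_measurable_rV (R : realType) d (Omega : set 'rV[R]_d) :
  open Omega -> measurable Omega.
Proof.
move=> /bigcup_rational_box ->; apply: bigcupT_measurable => k.
exact: open_box_measurable.
Qed.

Lemma continuous_measurable_fun_rV (R : realType) d (Omega : set 'rV[R]_d)
    (u : 'rV[R]_d -> R) :
  open Omega -> (forall x, Omega x -> {for x, continuous u}) ->
  measurable_fun Omega u.
Proof.
move=> oO cu mO; apply: (measurability _ (RGenOInfty.measurableE R)) => //.
move=> /= _ [_ [c ->] <-]; apply: open_measurable_rV.
rewrite openE => x [Ox /=]; rewrite in_itv/= andbT => cx.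
have : \forall y \near x, c < u y.
  exact: (cu x Ox _ (lt_nbhsr cx)).
have := open_nbhs_nbhs (conj oO Ox).
rewrite /interior; apply: filterS2 => y Oy cy; split => //.
by rewrite /= in_itv/= cy.
Qed.

(** * Measure of boxes and outer approximation by open boxes *)

Lemma box_set_measurable (R : realType) d (B : box R d) : measurable (box_set B).
Proof.
case: B => [[a b]|]/=; last exact: measurable0.
apply: measurable_forall_ord => i.
rewrite (_ : (fun x => _) = ~` [set x : 'rV[R]_d | x ord0 i < a ord0 i] `&`
    ~` [set x : 'rV[R]_d | b ord0 i < x ord0 i]).
  apply: measurableI; apply: measurableC.
    exact: measurable_coord_lt.
  exact: measurable_coord_gt.
apply/seteqP; split => x /=; rewrite !leNgt; first by move=> /andP[/negP ? /negP].
by move=> [/negP-> /negP->].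
Qed.

Lemma lebesgue_box_le (R : realType) d (B : box R d) :
  (lebesgue_rV R d (box_set B) <= box_vol B)%E.
Proof.
apply: ereal_inf_lbound; exists (fun k => if k is 0%N then B else None).
  by move=> x Bx; exists 0%N.
rewrite (nneseries_recl (P := xpredT))//=; last first.
  by move=> k _; exact: box_vol_ge0.
by rewrite eseries0 ?adde0// => -[].
Qed.

Lemma lebesgue_box_lty (R : realType) d (B : box R d) :
  (lebesgue_rV R d (box_set B) < +oo)%E.
Proof.
by apply: le_lt_trans (lebesgue_box_le _) _; case: B => [[a b]|]//=; exact: ltry.
Qed.

(* A face of a closed box is a degenerate closed box. *)
Lemma box_faces_negligible (R : realType) d (B : box R d) :
  (lebesgue_rV R d).-negligible (box_set B `\` open_box B).
Proof.
case: B => [[a b]|] /=; last by rewrite set0D; exact: negligible_set0.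
pose face (c : 'rV[R]_d) (i : 'I_d) : box R d :=
  Some (\row_j (if j == i then c ord0 j else a ord0 j),
  \row_j (if j == i then c ord0 j else b ord0 j)).
have face0 c i : (lebesgue_rV R d).-negligible (box_set (face c i)).
  apply/negligibleP; first exact: box_set_measurable.
  apply/eqP; rewrite eq_le measure_ge0 andbT.
  apply: le_trans (lebesgue_box_le _) _.
  (* The i-th side of the face has length 0, which annihilates the volume. *)
  by rewrite /= (bigD1 i)//= !mxE eqxx subrr maxxx mul0r.
(* The finitely many pairs of opposite faces are extended by empty sets to a sequence, to which
   countable subadditivity applies. *)
pose F k := if insub k is Some i then box_set (face a i) `|` box_set (face b i) else set0.
have F0 k : (lebesgue_rV R d).-negligible (F k).
  rewrite /F; case: insub => [i|]; last exact: negligible_set0.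
  exact: negligibleU.
apply: negligibleS (negligible_bigcup F0) => x [/= xab].
move/existsNP => [i /negP xi].
exists i => //; rewrite /F valK.
have /andP[ai bi] := xab i.
move: xi; rewrite negb_and -!leNgt => /orP[xi|xi]; [left|right] => j;
  rewrite !mxE; case: eqVneq => [->|_]; rewrite ?xab//.
  by rewrite ai xi.
by rewrite xi bi.
Qed.

(** A nearly optimal cover by closed boxes exceeds [E] by at most [e] in measure. Passing to the
    open boxes shrinks the union and loses only faces, which are null. *)
Lemma open_box_approx (R : realType) d (E : set 'rV[R]_d) (e : R) :
  measurable E -> (lebesgue_rV R d E < +oo)%E -> 0 < e ->
  exists B : nat -> box R d,
    (lebesgue_rV R d).-negligible (E `\` \bigcup_k open_box (B k)) /\
    (lebesgue_rV R d ((\bigcup_k open_box (B k)) `\` E) <= e%:E)%E.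
Proof.
move=> mE fE e0; have Efin : lebesgue_rV R d E \is a fin_num.
  by rewrite ge0_fin_numE// measure_ge0.
have [_ [B cB <-] Be] := lb_ereal_inf_adherent e0 Efin.
exists B; split.
  apply: negligibleS (negligible_bigcup (fun k => box_faces_negligible (B k))).
  move=> x [Ex nx]; have [k _ Bk] := cB _ Ex; exists k => //; split => //.
  by move=> Bkx; apply: nx; exists k.
have mC : measurable (\bigcup_k box_set (B k)).
  by apply: bigcupT_measurable => k; exact: box_set_measurable.
have mO : measurable (\bigcup_k open_box (B k)).
  by apply: bigcupT_measurable => k; exact: open_box_measurable.
have leC : (lebesgue_rV R d (\bigcup_k box_set (B k)) <= \sum_(k <oo) box_vol (B k))%E.
  by apply: ereal_inf_lbound; exists B.
apply: (@le_trans _ _ (lebesgue_rV R d ((\bigcup_k box_set (B k)) `\` E))).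
  apply: le_measure; rewrite ?inE; [exact: measurableD|exact: measurableD|].
  by move=> x [[k _ /open_box_sub ?] ?]; split => //; exists k.
rewrite measureD//; last first.
  by apply: le_lt_trans leC (lt_trans Be _); rewrite lte_add_pinfty// ltry.
rewrite (setIidr cB) leeBlDr//.
by apply: le_trans leC (le_trans (ltW Be) _); rewrite addeC.
Qed.

(** * Approximation in modular *)

Import HBNNSimple.

Lemma measurable_fun_scale d (T : measurableType d) (R : realType) (D : set T)
    (c : R) (u : T -> R) :
  measurable_fun D u -> measurable_fun D (fun x => c * u x).
Proof. by move=> mfu; exact: measurable_funM. Qed.

Lemma measurable_fun_norm d (T : measurableType d) (R : realType) (D : set T)
    (u : T -> R) :
  measurable_fun D u -> measurable_fun D (fun x => `|u x|).
Proof. by move=> mfu; exact: measurableT_comp. Qed.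

(** These conditions are required at every point of [D]; the domain is meant to be [Omega] with a
    null set removed, which turns almost-everywhere hypotheses into pointwise ones. The constants
    depend on [k] or [s] but not on the point. *)
Record growth_conditions d (T : measurableType d) (R : realType) (D : set T)
    (Phi : T -> R -> R) : Prop := GrowthConditions {
  growth_domain : measurable D;
  growth_measurable (u : T -> R) : measurable_fun D u ->
    measurable_fun D (fun x => Phi x `|u x|);
  growth_ge0 x t : D x -> 0 <= t -> 0 <= Phi x t;
  growth_mono x s t : D x -> 0 <= s -> s <= t -> Phi x s <= Phi x t;
  growth_doubling k : 0 <= k -> exists2 C, 0 <= C &
    forall x t, D x -> 0 <= t -> Phi x (k * t) <= C * Phi x t;
  growth_linear s : exists2 C, 0 <= C &
    forall x t, D x -> 0 <= t <= s -> Phi x t <= C * t }.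

(** The real counterpart of [MO_modular]: complex functions enter it through [normc] or through
    their real and imaginary parts. *)
Definition modular d (T : measurableType d) (R : realType)
    (mu : {measure set T -> \bar R}) (D : set T) (Phi : T -> R -> R)
    (u : T -> R) : \bar R :=
  (\int[mu]_(x in D) (Phi x `|u x|)%:E)%E.

Section modular_theory.
Context d (T : measurableType d) (R : realType).
Variables (mu : {measure set T -> \bar R}) (D : set T) (Phi : T -> R -> R).
Hypothesis Phi_growth : growth_conditions D Phi.
Implicit Types u v : T -> R.

Local Notation I := (modular mu D Phi).
Let mD := growth_domain Phi_growth.

Let mPhi u : measurable_fun D u ->
  measurable_fun D (fun x => (Phi x `|u x|)%:E).
Proof. by move=> mfu; apply/measurable_EFinP; exact: growth_measurable. Qed.

Let Phi0 x (t : R) : D x -> (0 <= (Phi x `|t|)%:E)%E.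
Proof. by move=> Dx; rewrite lee_fin (growth_ge0 Phi_growth). Qed.

Lemma modular_le u v : measurable_fun D u -> measurable_fun D v ->
  (forall x, D x -> `|u x| <= `|v x|) -> (I u <= I v)%E.
Proof.
move=> mfu mv uv; apply: ge0_le_integral => //.
- by move=> *; exact: Phi0.
- exact: mPhi.
- exact: mPhi.
by move=> x Dx; rewrite lee_fin (growth_mono Phi_growth)// uv.
Qed.

(** A substitute for the triangle inequality: |u + v| is at most twice the larger of |u| and |v|, so
    monotonicity bounds the integrand by one of the two terms, and the other is nonnegative. *)
Lemma modular_add u v : measurable_fun D u -> measurable_fun D v ->
  (I (fun x => u x + v x)%R <= I (fun x => 2 * u x)%R + I (fun x => 2 * v x)%R)%E.
Proof.
move=> mfu mv.
have m2 (w : T -> R) : measurable_fun D w -> measurable_fun D (fun x => 2 * w x).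
  exact: measurable_fun_scale.
rewrite /modular -ge0_integralD//; last 4 first.
- by move=> *; exact: Phi0.
- exact: (mPhi (m2 _ mfu)).
- by move=> *; exact: Phi0.
- exact: (mPhi (m2 _ mv)).
apply: ge0_le_integral => //.
- move=> *; exact: Phi0.
- by apply: mPhi; exact: measurable_funD.
- by apply: emeasurable_funD; [exact: (mPhi (m2 _ mfu))|exact: (mPhi (m2 _ mv))].
move=> x Dx; rewrite -EFinD lee_fin !normrM ger0_norm//.
have [uv|vu] := leP `|u x| `|v x|.
  apply: (@le_trans _ _ (Phi x (2 * `|v x|))).
    apply: (growth_mono Phi_growth) => //.
    by rewrite (le_trans (ler_normD _ _))// mulr_natl mulr2n lerD2r.
  by rewrite lerDr (growth_ge0 Phi_growth)// mulr_ge0.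
apply: (@le_trans _ _ (Phi x (2 * `|u x|))).
  apply: (growth_mono Phi_growth) => //.
  by rewrite (le_trans (ler_normD _ _))// mulr_natl mulr2n lerD2l ltW.
by rewrite lerDl (growth_ge0 Phi_growth)// mulr_ge0.
Qed.

Lemma modular_scale_lty k u : measurable_fun D u -> (I u < +oo)%E ->
  (I (fun x => k * u x)%R < +oo)%E.
Proof.
move=> mfu Iu; have [C C0 PC] := growth_doubling Phi_growth (normr_ge0 k).
apply: (@le_lt_trans _ _ (\int[mu]_(x in D) (C%:E * (Phi x `|u x|)%:E))%E).
  apply: ge0_le_integral => //.
  - by move=> *; exact: Phi0.
  - by apply: mPhi; exact: measurable_funM.
  - by apply: emeasurable_funM => //; exact: mPhi.
  - by move=> x Dx; rewrite -EFinM lee_fin normrM PC.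
rewrite ge0_integralZl//; last 2 first.
- exact: mPhi.
- move=> *; exact: Phi0.
by rewrite lte_mul_pinfty.
Qed.

(** Linear growth up to level |s| gives Phi(x, |u|) <= C |u| <= C |s| on [A] and 0 elsewhere. The
    constant serves all [u] and [A] at once. *)
Lemma modular_bounded s : exists2 C, 0 <= C &
  forall u A, measurable A -> measurable_fun D u ->
  (forall x, D x -> `|u x| <= s * \1_A x) -> (I u <= C%:E * mu A)%E.
Proof.
have [C C0 PC] := growth_linear Phi_growth `|s|.
exists (C * `|s|); first by rewrite mulr_ge0.
move=> u A mA mfu us.
apply: (@le_trans _ _ (\int[mu]_(x in D) ((C * `|s|)%:E * (\1_A x)%:E))%E).
  apply: ge0_le_integral => //.
  - by move=> *; exact: Phi0.
  - exact: mPhi.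
  - by apply: emeasurable_funM => //; apply/measurable_EFinP; exact: measurable_indic.
  - move=> x Dx; rewrite -EFinM lee_fin -mulrA.
    have us' : `|u x| <= `|s| * \1_A x.
      by apply: le_trans (us x Dx) _; rewrite ler_wpM2r// ler_norm.
    apply: le_trans (PC x _ Dx _) (ler_wpM2l C0 us').
    rewrite normr_ge0/= (le_trans us')// indicE; case: (_ \in _); by rewrite ?mulr1 ?mulr0.
rewrite ge0_integralZl//=; last 2 first.
- by apply/measurable_EFinP; exact: measurable_indic.
- by rewrite lee_fin mulr_ge0.
rewrite integral_indic// lee_wpmul2l ?lee_fin ?mulr_ge0// le_measure ?inE//.
exact: measurableI.
Qed.

(** The dominating function is Phi(x, |k v|), which is integrable by doubling. *)
Lemma modular_dominated_convergence (u_ : nat -> T -> R) u v :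
  (forall n, measurable_fun D (u_ n)) -> measurable_fun D u ->
  measurable_fun D v -> (I v < +oo)%E ->
  (forall n x, D x -> `|u x - u_ n x| <= `|v x|) ->
  (forall x, D x -> u_ ^~ x @ \oo --> u x) ->
  forall k e : R, 0 < e ->
  exists n, (I (fun x => k * (u x - u_ n x))%R <= e%:E)%E.
Proof.
move=> mfu mfl mv Iv uv cu k e e0.
have mkv : measurable_fun D (fun x => k * v x) by exact: measurable_funM.
have mw n : measurable_fun D (fun x => k * (u x - u_ n x)).
  by apply: measurable_funM => //; exact: measurable_funB.
have [] := @dominated_convergence _ T R mu D mD
  (fun n x => (Phi x `|k * (u x - u_ n x)|)%:E) (cst 0%E) (fun x => (Phi x `|k * v x|)%:E).
- by move=> n; exact: mPhi.
- exact: measurable_cst.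
- apply/aeW => x Dx.
  (* At a fixed point all arguments stay below |k| |v x|; the linear bound on that range acts as
     continuity of [Phi x] at 0 with value 0. *)
  have [C C0 PC] := growth_linear Phi_growth (`|k| * `|v x|).
  apply/fine_cvgP; split; first by near=> n.
  apply: (@squeeze_cvgr _ _ _ _ (cst 0) (fun n => C * `|k * (u x - u_ n x)|)).
  + near=> n; rewrite /= (growth_ge0 Phi_growth)//=; apply: PC => //.
    by rewrite normr_ge0/= normrM ler_wpM2l// uv.
  + exact: cvg_cst.
  + have : C * `|k * (u x - u_ n x)| @[n --> \oo] --> C * `|k * (u x - u x)|.
      apply: cvgM; first exact: cvg_cst.
      apply: cvg_norm; apply: cvgM; first exact: cvg_cst.
      by apply: cvgB; [exact: cvg_cst|exact: cu].
    by rewrite subrr mulr0 normr0 mulr0.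
- apply/integrableP; split; first exact: mPhi.
  under eq_integral => x /[!inE] Dx do rewrite gee0_abs ?Phi0//.
  exact: modular_scale_lty.
- apply/aeW => x n Dx; rewrite gee0_abs; last exact: Phi0.
  by rewrite lee_fin (growth_mono Phi_growth)// !normrM ler_wpM2l// uv.
move=> _ _ /=; rewrite integral0 => /fine_cvgP[fI /cvgrPdist_le/(_ e e0) cI].
have [n [fn]] := filter_ex (filterI fI cI).
rewrite /= sub0r normrN => In; exists n.
by rewrite /modular -(fineK fn) lee_fin (le_trans (ler_norm _)).
Unshelve. all: by end_near. Qed.

End modular_theory.

(** * Closure properties of approximable functions *)

Section approximation.
Context d (T : measurableType d) (R : realType).
Variables (mu : {measure set T -> \bar R}) (D : set T) (Phi : T -> R -> R).
Hypothesis Phi_growth : growth_conditions D Phi.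
Variable G : (T -> R) -> Prop.
Hypothesis G_measurable : forall g, G g -> measurable_fun D g.
Hypothesis G_cst0 : G (fun=> 0).
Hypothesis G_add : forall g h, G g -> G h -> G (fun x => g x + h x).
Hypothesis G_scale : forall c g, G g -> G (fun x => c * g x).
Implicit Types u v : T -> R.

Local Notation I := (modular mu D Phi).
Let mD := growth_domain Phi_growth.

(* Smallness of the modular at every scale [k] is convergence in norm. *)
Definition approximable u := forall k e : R, 0 < e ->
  exists2 g, G g & (I (fun x => k * (u x - g x))%R <= e%:E)%E.

(** The factor 2 lost in [modular_add] is harmless because approximation is available at every
    scale: both errors are taken at scale [2 * k] with tolerance [e / 2]. *)
Lemma approximable_lim u : measurable_fun D u ->
  (forall k e : R, 0 < e -> exists v, [/\ measurable_fun D v, approximable v &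
    (I (fun x => k * (u x - v x))%R <= e%:E)%E]) ->
  approximable u.
Proof.
move=> mfu uv k e e0; have e2 : 0 < e / 2 by rewrite divr_gt0.
have [v [mv av Iuv]] := uv (2 * k) _ e2.
have [g Gg Ivg] := av (2 * k) _ e2; exists g => //.
have mg := G_measurable Gg.
have -> : (fun x => k * (u x - g x)) =
    (fun x => k * (u x - v x) + k * (v x - g x)).
  by apply/funext => x; ring.
apply: le_trans (modular_add mu Phi_growth _ _) _.
- by apply: measurable_funM => //; exact: measurable_funB.
- by apply: measurable_funM => //; exact: measurable_funB.
under eq_fun do rewrite mulrA; under [X in (_ + I X)%E]eq_fun do rewrite mulrA.
by rewrite (splitr e) EFinD leeD.
Qed.

Lemma approximable_add u v : measurable_fun D u -> measurable_fun D v ->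
  approximable u -> approximable v -> approximable (fun x => u x + v x).
Proof.
move=> mfu mv au av k e e0; have e2 : 0 < e / 2 by rewrite divr_gt0.
have [g Gg Iug] := au (2 * k) _ e2; have [h Gh Ivh] := av (2 * k) _ e2.
exists (fun x => g x + h x); first exact: G_add.
have mg := G_measurable Gg; have mh := G_measurable Gh.
have -> : (fun x => k * (u x + v x - (g x + h x))) =
    (fun x => k * (u x - g x) + k * (v x - h x)).
  by apply/funext => x; ring.
apply: le_trans (modular_add mu Phi_growth _ _) _.
- by apply: measurable_funM => //; exact: measurable_funB.
- by apply: measurable_funM => //; exact: measurable_funB.
under eq_fun do rewrite mulrA; under [X in (_ + I X)%E]eq_fun do rewrite mulrA.
by rewrite (splitr e) EFinD leeD.
Qed.

Lemma approximable_scale c u : approximable u -> approximable (fun x => c * u x).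
Proof.
move=> au k e e0; have [g Gg Iug] := au (k * c) _ e0.
exists (fun x => c * g x); first exact: G_scale.
by under eq_fun do rewrite -mulrBr mulrA.
Qed.

Lemma approximable0 : approximable (fun=> 0).
Proof.
move=> k e e0; exists (fun=> 0) => //; rewrite subrr mulr0.
have [C C0 IC] := modular_bounded mu Phi_growth 0.
apply: le_trans (IC _ set0 _ _ _) _ => //.
- by move=> x _; rewrite normr0 mul0r.
- by rewrite measure0 mule0 lee_fin ltW.
Qed.

Lemma approximable_sum (J : eqType) (s : seq J) (F : J -> T -> R) :
  (forall j, measurable_fun D (F j)) -> (forall j, approximable (F j)) ->
  approximable (fun x => \sum_(j <- s) F j x).
Proof.
move=> mF aF; elim: s => [|j s IHs].
  by under eq_fun do rewrite big_nil; exact: approximable0.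
under eq_fun do rewrite big_cons.
by apply: approximable_add => //; exact: measurable_sum.
Qed.

Variable U : nat -> set T.
Hypothesis U_measurable : forall n, measurable (U n).
Hypothesis U_cover : forall x, D x -> \forall n \near \oo, U n x.
Hypothesis U_approximable : forall n A, measurable A -> A `<=` U n ->
  approximable \1_A.

(** Simple functions increasing to [u] are cut off to the sets [U n]. The errors are dominated by
    [u] itself and tend to 0 pointwise, because each point of [D] eventually belongs to [U n]. *)
Lemma approximable_nonneg u : measurable_fun D u -> (forall x, 0 <= u x) ->
  (I u < +oo)%E -> approximable u.
Proof.
move=> mfu u0 Iu; have mEu : measurable_fun D (EFin \o u) by exact/measurable_EFinP.
have Eu0 x : D x -> (0 <= (EFin \o u) x)%E by rewrite lee_fin u0.
pose s n := nnsfun_approx mD mEu n.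
pose v n (x : T) : R := s n x * \1_(U n) x.
have mv n : measurable_fun D (v n).
  apply: measurable_funM; last exact: measurable_indic.
  exact: measurable_funTS.
apply: approximable_lim => // k e e0.
have [||n In] := modular_dominated_convergence Phi_growth mv mfu mfu Iu _ _ k e0.
- move=> n x Dx.
  have sn : s n x <= u x by rewrite -lee_fin /s nnsfun_approxE; exact: (le_approx _ Eu0 Dx).
  have s0 : 0 <= s n x by [].
  rewrite /v indicE [X in _ <= X]ger0_norm//; case: (_ \in _).
    by rewrite mulr1 ger0_norm ?subr_ge0// gerBl.
  by rewrite mulr0 subr0 ger0_norm.
- move=> x Dx.
  have /fine_cvgP[_ cs] := cvg_nnsfun_approx mD mEu Eu0 Dx.
  apply: cvg_trans cs; apply: near_eq_cvg; near=> n.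
  by rewrite /v indicE mem_set ?mulr1//; near: n; exact: U_cover.
exists (v n); split => //.
(* The range of [s n] is finite, so the cut-off function is a finite linear combination of
   indicators of subsets of [U n]. *)
have -> : v n = (fun x => \sum_(y <- finmap.enum_fset (fset_set (range (s n))))
    (y * \1_((s n @^-1` [set y]) `&` U n) x)).
  apply/funext => x; rewrite /v fimfunE fsbig_finite//= mulr_suml.
  by apply: eq_bigr => y _; rewrite -mulrA indicI.
have mA y : measurable ((s n @^-1` [set y]) `&` U n).
  by apply: measurableI => //; rewrite -[X in measurable X]setTI; exact: measurable_funP.
apply: approximable_sum => y.
  by apply: measurable_funM => //; exact: measurable_indic.
apply: approximable_scale; apply: (U_approximable (n := n)) => //.
Unshelve. all: by end_near. Qed.

(** The positive and negative parts are both dominated by |u|, hence have finite modular. *)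
Lemma approximable_finite_modular u : measurable_fun D u -> (I u < +oo)%E ->
  approximable u.
Proof.
move=> mfu Iu.
have mpos : measurable_fun D (fun x => Num.max (u x) 0) by exact: measurable_maxr.
have mneg : measurable_fun D (fun x => Num.max (- u x) 0).
  by apply: measurable_maxr => //; exact: measurableT_comp.
have -> : u = (fun x => Num.max (u x) 0 + (-1) * Num.max (- u x) 0).
  apply/funext => x; rewrite /Order.max; case: ifPn; case: ifPn; lra.
apply: approximable_add => //; first exact: measurable_funM.
  apply: approximable_nonneg => // [x|]; first by rewrite le_max lexx orbT.
  apply: le_lt_trans Iu; apply: modular_le => // x _.
  rewrite ger0_norm ?le_max ?lexx ?orbT// ge_max normr_ge0 andbT.
  exact: ler_norm.
apply: approximable_scale; apply: approximable_nonneg => // [x|].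
  by rewrite le_max lexx orbT.
apply: le_lt_trans Iu; apply: modular_le => // x _.
rewrite ger0_norm ?le_max ?lexx ?orbT// ge_max normr_ge0 andbT.
by rewrite -normrN ler_norm.
Qed.

End approximation.

(** * Test functions *)

Lemma elementary_sum (R : realType) d I (s : seq I) (F : I -> 'rV[R]_d -> R) :
  (forall i, elementary (F i)) -> elementary (fun x => \sum_(i <- s) F i x).
Proof.
move=> eF; elim: s => [|i s IHs].
  by under eq_fun do rewrite big_nil; exact: elementary_cst.
by under eq_fun do rewrite big_cons; exact: elementary_add.
Qed.

Lemma elementary_prod (R : realType) d I (s : seq I) (F : I -> 'rV[R]_d -> R) :
  (forall i, elementary (F i)) -> elementary (fun x => \prod_(i <- s) F i x).
Proof.
move=> eF; elim: s => [|i s IHs].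
  by under eq_fun do rewrite big_nil; exact: elementary_cst.
by under eq_fun do rewrite big_cons; exact: elementary_mul.
Qed.

(* The coefficients [1] and [-1] are there to match [elementary_flat]. *)
Definition box_bump (R : realType) d (B : box R d) (x : 'rV[R]_d) : R :=
  if B is Some (a, b) then
    \prod_(i < d) (flat 0 (1 * x ord0 i + - a ord0 i) *
                   flat 0 (-1 * x ord0 i + b ord0 i))
  else 0.

Lemma elementary_box_bump (R : realType) d (B : box R d) :
  elementary (box_bump B).
Proof.
case: B => [[a b]|]; last exact: elementary_cst.
by apply: elementary_prod => i; apply: elementary_mul; exact: elementary_flat.
Qed.

Lemma box_bump_ge0 (R : realType) d (B : box R d) x : 0 <= box_bump B x.
Proof.
case: B => [[a b]|]//=; apply: prodr_ge0 => i _.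
by rewrite mulr_ge0// flat_ge0.
Qed.

Lemma box_bump_gt0 (R : realType) d (B : box R d) x :
  0 < box_bump B x <-> open_box B x.
Proof.
case: B => [[a b]|]/=; last by rewrite ltxx.
have E i : (0 < flat 0 (1 * x ord0 i + - a ord0 i) *
                flat 0 (-1 * x ord0 i + b ord0 i)) = (a ord0 i < x ord0 i < b ord0 i).
  have [ax|xa] := ltP (a ord0 i) (x ord0 i) => /=.
    by rewrite pmulr_rgt0 flat_gt0 ?mul1r ?mulN1r ?subr_gt0// addrC subr_gt0.
  have -> : flat 0 (1 * x ord0 i + - a ord0 i) = 0.
    by rewrite /flat mul1r subr_gt0 ltNge xa.
  by rewrite mul0r ltxx.
split=> [|h]; last by apply: prodr_gt0 => i _; rewrite E h.
move=> p i; rewrite -E lt_neqAle mulr_ge0 ?flat_ge0// andbT eq_sym.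
by move: p; apply: contraTneq => E0; rewrite (bigD1 i)//= E0 mul0r ltxx.
Qed.

(** Since the summands are nonnegative, the sum is positive exactly on the union of the first [n]
    open boxes. *)
Definition boxes_bump (R : realType) d (B : nat -> box R d) n (x : 'rV[R]_d) : R :=
  \sum_(k < n) box_bump (B k) x.

Lemma elementary_boxes_bump (R : realType) d (B : nat -> box R d) n :
  elementary (boxes_bump B n).
Proof. by apply: elementary_sum => k; exact: elementary_box_bump. Qed.

Lemma boxes_bump_ge0 (R : realType) d (B : nat -> box R d) n x :
  0 <= boxes_bump B n x.
Proof. by apply: sumr_ge0 => k _; exact: box_bump_ge0. Qed.

Lemma boxes_bump_gt0 (R : realType) d (B : nat -> box R d) n x :
  0 < boxes_bump B n x <-> exists2 k, (k < n)%N & open_box (B k) x.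
Proof.
split=> [|[k kn /box_bump_gt0 Bx]]; last first.
  rewrite /boxes_bump (bigD1 (Ordinal kn))//= ltr_pwDl//.
  by apply: sumr_ge0 => i _; exact: box_bump_ge0.
rewrite lt_neqAle boxes_bump_ge0 andbT eq_sym.
rewrite psumr_neq0 => [/hasP[k _ /=]|k _]; last exact: box_bump_ge0.
by move/box_bump_gt0; exists k.
Qed.

Lemma elementary_gt0_measurable (R : realType) d (u : 'rV[R]_d -> R) :
  elementary u -> measurable [set x | 0 < u x].
Proof.
move=> eu; apply: open_measurable_rV.
by apply: (@open_comp _ _ u [set y | 0 < y]) => [x _|];
  [exact: elementary_continuous|exact: open_gt].
Qed.

Lemma elementary_measurable (R : realType) d (D : set 'rV[R]_d) u :
  elementary u -> measurable_fun D u.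
Proof.
move=> eu; apply: measurable_funTS; apply: continuous_measurable_fun_rV.
  exact: openT.
by move=> x _; exact: elementary_continuous.
Qed.

Lemma lebesgue_compact_lty (R : realType) d (K : set 'rV[R]_d) :
  compact K -> exists2 A, measurable A & K `<=` A /\ (lebesgue_rV R d A < +oo)%E.
Proof.
move=> cK.
have bK i : exists M : R, forall x, K x -> `|x ord0 i| <= M.
  have /compact_bounded[M [_ KM]] : compact ((fun x : 'rV[R]_d => x ord0 i) @` K).
    apply: continuous_compact => //; apply: continuous_subspaceT => x.
    exact: coord_continuous.
  exists (M + 1) => x Kx; apply: (KM (M + 1)); first by rewrite ltrDl.
  by exists x.
have [M KM] := choice bK.
exists (box_set (Some (\row_i (- M i), \row_i M i))); first exact: box_set_measurable.
split; last exact: lebesgue_box_lty.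
by move=> x Kx i; rewrite !mxE -ler_norml KM.
Qed.

(** Any compact set outside which [g] vanishes may serve as [K], not only the support; this makes
    sums and products immediate. *)
Definition test_function (R : realType) d (Omega : set 'rV[R]_d)
    (g : 'rV[R]_d -> R) : Prop :=
  elementary g /\ exists K, [/\ compact K, K `<=` Omega &
    forall x, ~ K x -> g x = 0].

Lemma test_function_add (R : realType) d (Omega : set 'rV[R]_d) g h :
  test_function Omega g -> test_function Omega h ->
  test_function Omega (fun x => g x + h x).
Proof.
move=> [eg [K [cK KO gK]]] [eh [L [cL LO hL]]]; split; first exact: elementary_add.
exists (K `|` L); split; [exact: compactU|by rewrite subUset|].
by move=> x /not_orP[nK nL]; rewrite gK// hL// addr0.
Qed.

(** Test functions form an ideal among elementary functions: one compactly supported factor is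
    enough. This covers both scaling by constants and localisation by a bump. *)
Lemma test_function_mul (R : realType) d (Omega : set 'rV[R]_d) g h :
  elementary g -> test_function Omega h ->
  test_function Omega (fun x => g x * h x).
Proof.
move=> eg [eh [L [cL LO hL]]]; split; first exact: elementary_mul.
by exists L; split => // x nL; rewrite hL// mulr0.
Qed.

Lemma test_function0 (R : realType) d (Omega : set 'rV[R]_d) :
  test_function Omega (fun=> 0).
Proof.
split; first exact: elementary_cst.
by exists set0; split => //; exact: compact0.
Qed.

Lemma test_function_rational_bump (R : realType) d (Omega : set 'rV[R]_d) n :
  test_function Omega (boxes_bump (rational_box Omega) n).
Proof.
split; first exact: elementary_boxes_bump.
exists (\big[setU/set0]_(k < n) box_set (rational_box Omega k)); split.
- by apply: bigsetU_compact => k _; exact: box_set_compact.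
- rewrite -(bigcup_mkord n (fun k => box_set (rational_box Omega k))).
  by move=> x [k _]; exact: rational_box_sub.
- move=> x nx; apply/eqP; rewrite eq_le boxes_bump_ge0 andbT leNgt; apply/negP.
  move=> /boxes_bump_gt0[k kn kx]; apply: nx.
  rewrite -(bigcup_mkord n (fun k => box_set (rational_box Omega k))).
  by exists k => //; exact: open_box_sub.
Qed.

(** * Approximation of indicator functions by test functions *)

Section indicator_approximation.
Context (R : realType) (d : nat).
Variables (Omega D : set 'rV[R]_d) (Phi : 'rV[R]_d -> R -> R).
Hypothesis Phi_growth : growth_conditions D Phi.

Local Notation mu := (lebesgue_rV R d).
Local Notation I := (modular mu D Phi).
Local Notation approx := (approximable mu D Phi (test_function Omega)).

Let test_measurable g : test_function Omega g -> measurable_fun D g.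
Proof. by case=> eg _; exact: elementary_measurable. Qed.

Let modular_indic_lty A : measurable A -> (mu A < +oo)%E ->
  (I (\1_A : 'rV[R]_d -> R) < +oo)%E.
Proof.
move=> mA fA; have [C C0 IC] := modular_bounded mu Phi_growth 1.
apply: le_lt_trans (IC _ A mA _ _) _.
- exact: measurable_indic.
- by move=> x _; rewrite mul1r ger0_norm.
- by rewrite lte_mul_pinfty.
Qed.

(* [n u / (1 + n u)] increases to the indicator function of [0 < u]. *)
Lemma approximable_gt0 u : test_function Omega u -> (forall x, 0 <= u x) ->
  approx \1_[set x | 0 < u x].
Proof.
move=> tu u0; have [eu [K [cK _ uK]]] := tu.
have [A mA [KA fA]] := lebesgue_compact_lty cK.
pose c n x : R := 1 + n%:R * u x.
have c0 n x : 0 < c n x by rewrite /c ltr_pwDl// mulr_ge0.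
pose g n x : R := (n%:R * (c n x)^-1) * u x.
have tg n : test_function Omega (g n).
  apply: test_function_mul => //; apply: elementary_mul; first exact: elementary_cst.
  apply: elementary_inv => //; apply: elementary_add; first exact: elementary_cst.
  by apply: elementary_mul => //; exact: elementary_cst.
have mI (B : set 'rV[R]_d) : measurable B -> measurable_fun D (\1_B : 'rV[R]_d -> R).
  by move=> mB; exact: measurable_indic.
have mu0 := elementary_gt0_measurable eu.
(* The error on the set where [u] is positive is 1 / (1 + n u): it lies between 0 and 1, and it
   tends to 0 there. *)
have g1 n x : 1 - g n x = (c n x)^-1.
  rewrite /g; have := c0 n x; rewrite /c => /lt0r_neq0 ?; field => //.
move=> k e e0.
have [||n In] := modular_dominated_convergence Phi_growth
  (fun n => test_measurable (tg n)) (mI _ mu0) (mI _ mA) (modular_indic_lty mA fA) _ _ k e0.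
- move=> n x Dx; rewrite !indicE.
  have [ux|ux] := ltP 0 (u x).
    rewrite [x \in [set y | 0 < u y]]mem_set// [x \in A]mem_set ?normr1; last first.
      by apply: KA; apply: contrapT => /uK uK0; rewrite uK0 ltxx in ux.
    rewrite g1 normfV ger0_norm ?(ltW (c0 _ _))// invf_le1//.
    by rewrite lerDl mulr_ge0.
  have uE : u x = 0 by apply/eqP; rewrite eq_le ux u0.
  by rewrite memNset/= ?uE ?ltxx// /g uE mulr0 subr0 normr0.
- move=> x Dx; rewrite indicE.
  have [ux|ux] := ltP 0 (u x); last first.
    have uE : u x = 0 by apply/eqP; rewrite eq_le ux u0.
    rewrite memNset/= ?uE ?ltxx//; apply: cvg_near_cst.
    by apply: nearW => n; rewrite /g uE mulr0.
  rewrite mem_set//=.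
  apply/cvgrPdist_le => a a0; near=> n.
  rewrite g1 normfV ger0_norm ?(ltW (c0 _ _))// invf_ple ?posrE//.
  (* The condition 1 / (1 + n u) <= a amounts to n >= (1/a - 1) / u. *)
  rewrite /c -lerBlDl -ler_pdivrMr//; near: n; exact: nbhs_infty_ger.
by exists (g n).
Unshelve. all: by end_near. Qed.

Lemma approximable_indic n A : measurable A ->
  A `<=` [set x | 0 < boxes_bump (rational_box Omega) n x] -> approx \1_A.
Proof.
move=> mA; set q := boxes_bump _ n => Aq.
have tq : test_function Omega q by exact: test_function_rational_bump.
have q0 x : 0 <= q x by exact: boxes_bump_ge0.
have [eq [K [cK _ qK]]] := tq.
have [F mF [KF fF]] := lebesgue_compact_lty cK.
have qF x : 0 < q x -> F x.
  by move=> qx; apply: KF; apply: contrapT => /qK qE; rewrite qE ltxx in qx.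
have mI (B : set 'rV[R]_d) : measurable B -> measurable_fun D (\1_B : 'rV[R]_d -> R).
  by move=> mB; exact: measurable_indic.
have mq := elementary_gt0_measurable eq.
have fA : (mu A < +oo)%E.
  by apply: le_lt_trans fF; apply: le_measure; rewrite ?inE// => x /Aq /qF.
apply: (approximable_lim Phi_growth test_measurable (mI _ mA)) => k e e0.
have [C C0 IC] := modular_bounded mu Phi_growth `|k|.
(* Dividing by [C + 1] avoids the case C = 0, and C e / (C + 1) <= e still holds. *)
have d0 : 0 < e / (C + 1) by rewrite divr_gt0// ltr_wpDl.
have [B [AV VA]] := open_box_approx mA fA d0.
set V := \bigcup_j open_box (B j) in AV VA.
have mV : measurable V.
  by apply: bigcupT_measurable => j; exact: open_box_measurable.
pose E := V `&` [set x | 0 < q x].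
have mE : measurable E by exact: measurableI.
exists \1_E; split; first exact: mI.
- apply: (approximable_lim Phi_growth test_measurable (mI _ mE)) => k' e' e0'.
  (* The boxes [B j] may leave [Omega]; the factor [q] restores compact support. The positivity sets
     of [w m] increase to [E]. *)
  pose w m x : R := boxes_bump B m x * q x.
  have tw m : test_function Omega (w m).
    by apply: test_function_mul => //; exact: elementary_boxes_bump.
  have w0 m x : 0 <= w m x by rewrite mulr_ge0// boxes_bump_ge0.
  have mw m := elementary_gt0_measurable (tw m).1.
  have wE m x : 0 < w m x -> E x.
    move=> wx; have qx : 0 < q x.
      rewrite lt_neqAle q0 andbT eq_sym; apply: contraTneq wx.
      by rewrite /w => ->; rewrite mulr0 ltxx.
    move: wx; rewrite /w pmulr_lgt0// => /boxes_bump_gt0[j _ Bj].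
    by split => //; exists j.
  have [||m Im] := modular_dominated_convergence Phi_growth
    (fun m => mI _ (mw m)) (mI _ mE) (mI _ mF) (modular_indic_lty mF fF) _ _ k' e0'.
  + move=> m x Dx; rewrite !indicE.
    have [xE|xE] := pselect (E x); last first.
      by rewrite (memNset xE) memNset ?subr0 ?normr0// => /wE.
    rewrite (mem_set xE) (mem_set (qF _ xE.2)) normr1.
    by case: (_ \in _); rewrite ?subrr ?subr0 ?normr0 ?normr1.
  + move=> x Dx; apply: cvg_near_cst; rewrite !indicE.
    have [xE|xE] := pselect (E x); last first.
      by apply: nearW => m; rewrite indicE (memNset xE) memNset// => /wE.
    have [[j _ Bj] qx] := xE; exists j.+1 => // m /= jm.
    rewrite indicE (mem_set xE) mem_set//= /w mulr_gt0//.
    by apply/boxes_bump_gt0; exists j.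
  exists \1_[set x | 0 < w m x]; split => //.
  exact: approximable_gt0.
(* Off [S] the indicators of [A] and [E] agree, because [A] lies in the set where [q] is positive.
   The part [A] minus [V] is null, so only the excess of [V] counts. *)
- pose S := (A `\` V) `|` (V `\` A).
  have mS : measurable S by apply: measurableU; exact: measurableD.
  apply: le_trans (IC _ S mS _ _) _.
  + exact: (measurable_fun_scale _ (measurable_funB (mI _ mA) (mI _ mE))).
  + move=> x Dx; rewrite normrM ler_wpM2l// !indicE.
    have [xS|xS] := pselect (S x).
      rewrite (mem_set xS); do 2 case: (_ \in _);
        by rewrite ?subrr ?subr0 ?sub0r ?normrN ?normr0 ?normr1.
    rewrite (memNset xS); have [xA|xA] := pselect (A x).
      rewrite (mem_set xA) mem_set ?subrr ?normr0//; split; last exact: Aq.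
      by apply: contrapT => xV; apply: xS; left.
    rewrite (memNset xA) memNset ?subrr ?normr0// => -[xV _].
    by apply: xS; right.
  apply: (@le_trans _ _ (C%:E * (e / (C + 1))%:E)%E).
    rewrite lee_wpmul2l ?lee_fin//.
    apply: le_trans (measureU2 mu _ _) _; try exact: measurableD.
    by rewrite (measure_negligible _ AV) ?add0e//; exact: measurableD.
  rewrite -EFinM lee_fin mulrCA ger_pMr// ler_pdivrMr ?ltr_wpDl// mul1r.
  by rewrite lerDl.
Unshelve. all: by end_near. Qed.

End indicator_approximation.

(** * Double phase functionals *)

Import ComplexField.Normc.

(** The exponent varies with the point, so the power is split by cases: for base 0 it is 1 or 0
    according to whether the exponent vanishes, otherwise it is exp(g ln f). *)
Lemma powR_measurable d (T : measurableType d) (R : realType) (D : set T)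
    (f g : T -> R) : measurable_fun D f -> measurable_fun D g ->
  measurable_fun D (fun x => f x `^ g x).
Proof.
move=> mf mg mD; move: (mD); rewrite /powR; apply: measurable_fun_if => //.
- exact: measurable_fun_eqr.
- apply: (@measurable_funS _ _ _ _ D) => //.
  rewrite (_ : (fun x => _) = (fun x => if g x == 0 then 1 else 0)); last first.
    by apply/funext => x; case: eqP.
  by apply: measurable_fun_if => //; exact: measurable_fun_eqr.
- apply: (@measurable_funS _ _ _ _ D) => //.
  apply: (@measurableT_comp _ _ _ _ _ _ (@expR R)) => //.
  apply: measurable_funM => //.
  exact: (@measurableT_comp _ _ _ _ _ _ (@ln R)).
Qed.

Lemma double_phase_measurable d (T : measurableType d) (R : realType)
    (D : set T) (a p r u : T -> R) :
  measurable_fun D a -> measurable_fun D p -> measurable_fun D r ->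
  measurable_fun D u -> measurable_fun D (fun x => double_phase a p r x (u x)).
Proof.
move=> ma mp mr mfu; apply: measurable_funD; first exact: powR_measurable.
by apply: measurable_funM => //; exact: powR_measurable.
Qed.

(** Each condition reduces to one on t^q with 1 <= q <= M, where k^q <= max(1, k)^M. Where [a]
    vanishes, [r] may exceed [M], but the second term is 0. *)
Lemma double_phase_growth d (T : measurableType d) (R : realType) (D : set T)
    (a p r : T -> R) (A M : R) :
  measurable D ->
  measurable_fun D a -> measurable_fun D p -> measurable_fun D r ->
  0 <= A ->
  (forall x, D x -> [/\ 0 <= a x <= A, 1 <= p x <= M, 1 <= r x &
    a x != 0 -> r x <= M]) ->
  growth_conditions D (double_phase a p r).
Proof.
move=> mD ma mp mr A0 H.
have pw_mono (q s t : R) : 1 <= q -> 0 <= s -> s <= t -> s `^ q <= t `^ q.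
  move=> q1 s0 st; apply: ge0_ler_powR => //.
  - by rewrite (le_trans _ q1).
  - by rewrite nnegrE (le_trans s0).
have pw_dbl (q k t : R) : 1 <= q -> q <= M -> 0 <= k -> 0 <= t ->
    (k * t) `^ q <= Num.max 1 k `^ M * t `^ q.
  move=> q1 qM k0 t0; rewrite powRM// ler_wpM2r ?powR_ge0//.
  apply: (@le_trans _ _ (Num.max 1 k `^ q)).
    by apply: pw_mono => //; rewrite le_max lexx orbT.
  by rewrite ler_powR// le_max lexx.
have pw_lin (q s t : R) : 1 <= q -> q <= M -> 0 <= t <= s ->
    t `^ q <= Num.max 1 s `^ M * t.
  move=> q1 qM /andP[t0 ts]; set S := Num.max 1 s.
  have S1 : 1 <= S by rewrite le_max lexx.
  have S0 : 0 < S by rewrite (lt_le_trans _ S1).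
  have [->|tn0] := eqVneq t 0.
    by rewrite powR0 ?mulr0// gt_eqF// (lt_le_trans _ q1).
  have tp : 0 < t by rewrite lt_neqAle eq_sym tn0.
  (* Write t = (t / S) S: the factor t / S lies in (0, 1], so its q-th power is at most itself,
     hence at most t, while S^q <= S^M. *)
  rewrite -{1}(divfK (lt0r_neq0 S0) t) powRM ?divr_ge0// ?(ltW S0)// mulrC.
  apply: ler_pM; rewrite ?powR_ge0//; first by rewrite ler_powR.
  apply: (@le_trans _ _ (t / S)); last by rewrite ler_pdivrMr// ler_peMr.
  apply: ge1r_powR => //; rewrite divr_gt0//= ler_pdivrMr// mul1r.
  by rewrite (le_trans ts)// le_max lexx orbT.
split => //.
- move=> u mfu; apply: double_phase_measurable => //.
  exact: measurable_fun_norm.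
- move=> x t Dx t0; have [/andP[a0 _] _ _ _] := H x Dx.
  by rewrite addr_ge0 ?mulr_ge0 ?powR_ge0.
- move=> x s t Dx s0 st; have [/andP[a0 _] /andP[p1 _] r1 _] := H x Dx.
  by rewrite lerD ?ler_wpM2l ?pw_mono.
- move=> k k0; exists (Num.max 1 k `^ M); first exact: powR_ge0.
  move=> x t Dx t0; have [/andP[a0 _] /andP[p1 pM] r1 rM] := H x Dx.
  rewrite /double_phase mulrDr lerD ?pw_dbl// mulrCA.
  have [->|an0] := eqVneq (a x) 0; first by rewrite !mul0r.
  by rewrite ler_wpM2l// pw_dbl// rM.
- move=> s; exists (Num.max 1 s `^ M * (1 + A)).
    by rewrite mulr_ge0 ?powR_ge0// addr_ge0.
  move=> x t Dx ts; have [/andP[a0 aA] /andP[p1 pM] r1 rM] := H x Dx.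
  have /andP[t0 _] := ts.
  rewrite /double_phase mulrDr mulr1 mulrDl lerD ?pw_lin//.
  rewrite [_ * A]mulrC -mulrA.
  have [->|an0] := eqVneq (a x) 0.
    by rewrite mul0r !mulr_ge0 ?powR_ge0.
  by apply: ler_pM => //; [exact: powR_ge0|rewrite pw_lin// rM].
Qed.

Lemma ess_sup_on_lty d (T : measurableType d) (R : realType)
    (mu : {measure set T -> \bar R}) (D : set T) (f : T -> R) :
  (ess_sup_on mu D (EFin \o f) < +oo)%E ->
  exists2 M, 0 <= M & {ae mu, forall x, D x -> f x <= M}.
Proof.
(* The essential bound [y] may be -oo; then almost no point lies in [D] and any real number is a
   bound. The maximum with 0 makes the bound nonnegative. *)
move=> /ereal_inf_lt[y /= fy yoo]; exists (Num.max 0 (fine y)).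
  by rewrite le_max lexx.
apply: filterS fy => x fxy Dx; have := fxy Dx.
by case: y yoo {fxy} => [y _|//|_]//=; rewrite lee_fin le_max => ->; rewrite orbT.
Qed.

(** * Complex modulus, measurability and the complex modular *)

Lemma normc_le_ReIm (R : rcfType) (z : R[i]) :
  normc z <= `|complex.Re z| + `|complex.Im z|.
Proof.
case: z => a b /=; have ab0 : 0 <= `|a| + `|b| by rewrite addr_ge0.
rewrite -[leRHS](ger0_norm ab0) -(sqrtr_sqr (`|a| + `|b|)) ler_wsqrtr//.
rewrite sqrrD !real_normK ?num_real// -addrAC lerDl.
by rewrite mulrn_wge0// mulr_ge0.
Qed.

Lemma Re_le_normc (R : rcfType) (z : R[i]) : `|complex.Re z| <= normc z.
Proof.
by case: z => a b /=; rewrite -sqrtr_sqr ler_wsqrtr// lerDl sqr_ge0.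
Qed.

Lemma Im_le_normc (R : rcfType) (z : R[i]) : `|complex.Im z| <= normc z.
Proof.
by case: z => a b /=; rewrite -sqrtr_sqr ler_wsqrtr// lerDr sqr_ge0.
Qed.

Lemma normc_ge0 (R : rcfType) (z : R[i]) : 0 <= normc z.
Proof. by case: z => a b /=; exact: sqrtr_ge0. Qed.

Lemma normc_scale (R : rcfType) (l : R) (z : R[i]) :
  normc (l%:C%C * z) = `|l| * normc z.
Proof. by rewrite normcM /= expr0n/= addr0 sqrtr_sqr. Qed.

Lemma normc_div (R : rcfType) (l : R) (z : R[i]) :
  normc (z / l%:C%C) = `|l|^-1 * normc z.
Proof. by rewrite normcM normcV /= expr0n/= addr0 sqrtr_sqr mulrC. Qed.

Lemma normc_measurable (R : realType) d (Omega : set 'rV[R]_d) f :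
  cmeasurable_fun Omega f -> measurable_fun Omega (fun x => normc (f x)).
Proof.
move=> [mRe mIm].
have -> : (fun x => normc (f x)) = (fun x => Num.sqrt
    (complex.Re (f x) * complex.Re (f x) + complex.Im (f x) * complex.Im (f x))).
  by apply/funext => x; case: (f x).
apply: (@measurableT_comp _ _ _ _ _ _ (@Num.sqrt R)).
  by apply: continuous_measurable_fun; exact: sqrt_continuous.
by apply: measurable_funD; exact: measurable_funM.
Qed.

Lemma cmeasurable_scale (R : realType) d (Omega : set 'rV[R]_d) (l : R) f :
  cmeasurable_fun Omega f -> cmeasurable_fun Omega (fun x => l%:C%C * f x).
Proof.
move=> [mRe mIm]; split.
  rewrite (_ : (fun x => _) = (fun x => l * complex.Re (f x))).
    exact: (measurable_fun_scale _ mRe).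
  by apply/funext => x; case: (f x) => u v /=; rewrite mul0r subr0.
rewrite (_ : (fun x => _) = (fun x => l * complex.Im (f x))).
  exact: (measurable_fun_scale _ mIm).
by apply/funext => x; case: (f x) => u v /=; rewrite mul0r addr0.
Qed.

Lemma cmeasurable_sub (R : realType) d (Omega : set 'rV[R]_d) f g :
  cmeasurable_fun Omega f -> cmeasurable_fun Omega g ->
  cmeasurable_fun Omega (fun x => f x - g x).
Proof.
move=> [fRe fIm] [gRe gIm]; split.
  rewrite (_ : (fun x => _) = (fun x => complex.Re (f x) - complex.Re (g x))).
    exact: (measurable_funB fRe gRe).
  by apply/funext => x; case: (f x); case: (g x).
rewrite (_ : (fun x => _) = (fun x => complex.Im (f x) - complex.Im (g x))).
  exact: (measurable_funB fIm gIm).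
by apply/funext => x; case: (f x); case: (g x).
Qed.

Lemma integral_setD_null d (T : measurableType d) (R : realType)
    (mu : {measure set T -> \bar R}) (D N : set T) (f : T -> \bar R) :
  measurable D -> measurable N -> measurable_fun D f -> mu N = 0%E ->
  (\int[mu]_(x in D) f x = \int[mu]_(x in D `\` N) f x)%E.
Proof.
move=> mD mN mf N0; rewrite integralE [in RHS]integralE.
by congr (_ - _)%E; apply: ge0_negligible_integral => //;
  [exact: measurable_funepos|exact: measurable_funeneg].
Qed.

(** Removing the null set [N] leaves the integral unchanged; this moves the complex modular to a
    domain where the growth conditions can hold at every point. *)
Lemma MO_modularE (R : realType) d (Omega N : set 'rV[R]_d)
    (a p r : 'rV[R]_d -> R) f :
  open Omega ->
  measurable_fun Omega a -> measurable_fun Omega p -> measurable_fun Omega r ->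
  measurable N -> lebesgue_rV R d N = 0%E -> cmeasurable_fun Omega f ->
  MO_modular Omega (double_phase a p r) f =
  modular (lebesgue_rV R d) (Omega `\` N) (double_phase a p r)
    (fun x => normc (f x)).
Proof.
move=> oO ma mp mr mN N0 mf; have mO := open_measurable_rV oO.
have mnf := normc_measurable mf.
rewrite /MO_modular (integral_setD_null mO mN _ N0).
  by apply: eq_integral => x _; rewrite ger0_norm// normc_ge0.
apply/measurable_EFinP; exact: (double_phase_measurable ma mp mr mnf).
Qed.

(** The real and imaginary parts are continuous near the compact support, hence bounded on it, and
    the support lies in a set of finite measure; [modular_bounded] then applies with scale 1. *)
Lemma Cc_infty_MO_space (R : realType) d (Omega N : set 'rV[R]_d)
    (a p r : 'rV[R]_d -> R) :
  open Omega ->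
  measurable_fun Omega a -> measurable_fun Omega p -> measurable_fun Omega r ->
  measurable N -> lebesgue_rV R d N = 0%E ->
  growth_conditions (Omega `\` N) (double_phase a p r) ->
  Cc_infty Omega `<=` MO_space Omega (double_phase a p r).
Proof.
move=> oO ma mp mr mN N0 Hg f [sRe sIm cK KO].
have cRe x : Omega x -> {for x, continuous (fun x => complex.Re (f x))}.
  by move=> Ox; have [] := sRe [::] x Ox.
have cIm x : Omega x -> {for x, continuous (fun x => complex.Im (f x))}.
  by move=> Ox; have [] := sIm [::] x Ox.
have mf : cmeasurable_fun Omega f.
  by split; exact: continuous_measurable_fun_rV.
split=> //; exists 1 => //.
rewrite (_ : (fun x => _) = f); last first.
  by apply/funext => x; rewrite (_ : 1%:C%C = 1)// mul1r.
have bnd (u : 'rV[R]_d -> R) : (forall x, Omega x -> {for x, continuous u}) ->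
    exists M, forall x, support_on Omega f x -> `|u x| <= M.
  move=> cu; have /compact_bounded[M [_ KM]] : compact (u @` support_on Omega f).
    apply: continuous_compact => //; apply: continuous_in_subspaceT => x.
    by rewrite inE => /KO /cu.
  exists (M + 1) => x Kx; apply: (KM (M + 1)); first by rewrite ltrDl.
  by exists x.
have [M1 H1] := bnd _ cRe; have [M2 H2] := bnd _ cIm.
have [A mA [KA fA]] := lebesgue_compact_lty cK.
rewrite (MO_modularE oO ma mp mr mN N0 mf).
have [C C0 IC] := modular_bounded (lebesgue_rV R d) Hg (`|M1| + `|M2|).
apply: le_lt_trans (IC _ A mA _ _) _; last by rewrite lte_mul_pinfty.
  exact: measurable_funS (open_measurable_rV oO) (@subDsetl _ _ _) (normc_measurable mf).
move=> x [Ox _]; rewrite ger0_norm ?normc_ge0// indicE.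
have [fx0|fx0] := eqVneq (f x) 0.
  by rewrite fx0 normc0 mulr_ge0.
have Kx : support_on Omega f x by apply: subset_closure.
rewrite mem_set ?mulr1; last exact: KA.
apply: le_trans (normc_le_ReIm _) _.
by rewrite lerD// (le_trans _ (ler_norm _)) ?H1 ?H2.
Qed.

Lemma test_function_Cc_infty (R : realType) d (Omega : set 'rV[R]_d) g h :
  test_function Omega g -> test_function Omega h ->
  Cc_infty Omega (fun x => (g x +i* h x)%C).
Proof.
move=> [eg [K [cK KO gK]]] [eh [L [cL LO hL]]].
have cKL : compact (K `|` L) by exact: compactU.
have sKL : support_on Omega (fun x => (g x +i* h x)%C) `<=` K `|` L.
  have /closure_id -> : closed (K `|` L).
    by apply: compact_closed => //; exact: norm_hausdorff.
  apply: closureS => x [_ /= ghx]; apply: contrapT => /not_orP[nK nL].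
  by move: ghx; rewrite gK// hL// eqxx.
split; [exact: elementary_smooth|exact: elementary_smooth| |].
  by apply: (subclosed_compact _ cKL) => //; exact: closed_closure.
by apply: subset_trans sKL _; rewrite subUset.
Qed.

(** * Density in the modular, for real and then complex functions *)

Section density.
Context (R : realType) (d : nat).
Variables (Omega D : set 'rV[R]_d) (Phi : 'rV[R]_d -> R -> R).
Hypothesis Omega_open : open Omega.
Hypothesis D_sub : D `<=` Omega.
Hypothesis Phi_growth : growth_conditions D Phi.

Local Notation mu := (lebesgue_rV R d).
Local Notation I := (modular mu D Phi).

Let test_measurable g : test_function Omega g -> measurable_fun D g.
Proof. by case=> eg _; exact: elementary_measurable. Qed.

Lemma approximable_test_function u : measurable_fun D u -> (I u < +oo)%E ->
  approximable mu D Phi (test_function Omega) u.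
Proof.
apply: (@approximable_finite_modular _ _ _ mu D Phi Phi_growth
  (test_function Omega) test_measurable _ _ _
  (fun n => [set x | 0 < boxes_bump (rational_box Omega) n x])).
- exact: test_function0.
- by move=> g h; exact: test_function_add.
- by move=> c g; apply: test_function_mul; exact: elementary_cst.
- by move=> n; apply: elementary_gt0_measurable; exact: elementary_boxes_bump.
- move=> x /D_sub; rewrite {1}(bigcup_rational_box Omega_open) => -[k _ kx].
  by exists k.+1 => // n /= kn; apply/boxes_bump_gt0; exists k.
- by move=> n A; exact: approximable_indic.
Qed.

Lemma complex_test_function_approx (f : 'rV[R]_d -> R[i]) (l c : R) :
  cmeasurable_fun Omega f -> l != 0 -> 0 < c ->
  (I (fun x => normc (l%:C%C * f x))%R < +oo)%E ->
  exists2 g, Cc_infty Omega g & (I (fun x => normc ((f x - g x) / c%:C%C))%R <= 1)%E.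
Proof.
move=> mf l0 c0 If; have mD := growth_domain Phi_growth.
have mO := open_measurable_rV Omega_open.
have mS (u : 'rV[R]_d -> R) : measurable_fun Omega u -> measurable_fun D u.
  exact: measurable_funS.
have mnf := mS _ (normc_measurable mf).
have mlf : measurable_fun D (fun x => normc (l%:C%C * f x)).
  under eq_fun do rewrite normc_scale.
  exact: (measurable_fun_scale _ mnf).
have part (u : 'rV[R]_d -> R) : measurable_fun D u ->
    (forall x, `|u x| <= normc (f x)) ->
    approximable mu D Phi (test_function Omega) u.
  move=> mfu uf; apply: approximable_test_function => //.
  (* Doubling undoes the scale [l], so the modular of [f] itself is finite. *)
  apply: le_lt_trans (modular_scale_lty Phi_growth `|l|^-1 mlf If).
  apply: (modular_le mu Phi_growth mfu (measurable_fun_scale _ mlf)).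
  move=> x Dx; rewrite normc_scale mulKf ?normr_eq0//.
  by rewrite [leRHS]ger0_norm ?normc_ge0.
have mRe := mS _ mf.1; have mIm := mS _ mf.2.
(* The real and imaginary parts each contribute at most 1/2. The scale is 1/c from the norm times
   the 2 lost in [modular_add]. *)
have h0 : 0 < 2^-1 :> R by [].
have [g tg Ig] := part _ mRe (fun x => Re_le_normc (f x)) (2 * c^-1) _ h0.
have [h th Ih] := part _ mIm (fun x => Im_le_normc (f x)) (2 * c^-1) _ h0.
exists (fun x => (g x +i* h x)%C); first exact: test_function_Cc_infty.
have mg := test_measurable tg; have mh := test_measurable th.
pose U x := `|complex.Re (f x) - g x|; pose V x := `|complex.Im (f x) - h x|.
have mfg := measurable_funB mRe mg; have mfh := measurable_funB mIm mh.
have mU : measurable_fun D U by exact: (measurable_fun_norm mfg).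
have mV : measurable_fun D V by exact: (measurable_fun_norm mfh).
have mcU := measurable_fun_scale c^-1 mU.
have mcV := measurable_fun_scale c^-1 mV.
have cgh : cmeasurable_fun Omega (fun x => (g x +i* h x)%C).
  by split; [exact: (elementary_measurable tg.1)|exact: (elementary_measurable th.1)].
have mn : measurable_fun D (fun x => normc ((f x - (g x +i* h x)%C) / c%:C%C)).
  under eq_fun do rewrite normc_div.
  exact: (measurable_fun_scale _ (mS _ (normc_measurable (cmeasurable_sub mf cgh)))).
apply: (@le_trans _ _ (I (fun x => c^-1 * U x + c^-1 * V x))).
  apply: (modular_le mu Phi_growth mn (measurable_funD mcU mcV)).
  move=> x Dx; rewrite normc_div (gtr0_norm c0) /= -mulrDr /U /V.
  rewrite [leRHS]ger0_norm ?mulr_ge0 ?invr_ge0 ?addr_ge0 ?(ltW c0)//.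
  rewrite ger0_norm ?mulr_ge0 ?invr_ge0 ?normc_ge0 ?(ltW c0)//.
  rewrite ler_wpM2l ?invr_ge0 ?(ltW c0)//.
  by apply: le_trans (normc_le_ReIm _) _; case: (f x).
apply: le_trans (modular_add mu Phi_growth mcU mcV) _.
rewrite [leRHS](_ : _ = 2^-1%:E + 2^-1%:E)%E; last by rewrite -EFinD; congr EFin; lra.
apply: leeD.
  apply: le_trans Ig.
  apply: (modular_le mu Phi_growth (measurable_fun_scale _ mcU) (measurable_fun_scale _ mfg)).
  by move=> x Dx; rewrite mulrA !normrM normr_id.
apply: le_trans Ih.
apply: (modular_le mu Phi_growth (measurable_fun_scale _ mcV) (measurable_fun_scale _ mfh)).
by move=> x Dx; rewrite mulrA !normrM normr_id.
Qed.

End density.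

Theorem corollary12 (R : realType) (d : nat) (Omega : set 'rV[R]_d)
    (a p r : 'rV[R]_d -> R) :
  let mu := lebesgue_rV R d in
  let Omega1 := Omega `&` [set x | a x != 0] in
  open Omega ->
  measurable_fun Omega a -> measurable_fun Omega p -> measurable_fun Omega r ->
  {ae mu, forall x, Omega x -> 0 <= a x /\ 1 <= p x <= r x} ->
  (ess_sup_on mu Omega (fun x => `|a x|%:E) < +oo)%E ->
  (ess_sup_on mu Omega (fun x => (r x)%:E) < +oo)%E \/
  [/\ {ae mu, forall x, Omega1 x -> p x < r x},
      (ess_sup_on mu Omega (fun x => (p x)%:E) < +oo)%E &
      (ess_sup_on mu Omega1 (fun x => (r x)%:E) < +oo)%E] ->
  MO_dense Omega (double_phase a p r) (Cc_infty Omega).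
Proof.
move=> mu Omega1 oO ma mp mr Hpr Ha Hi.
have [A A0 HA] := ess_sup_on_lty Ha.
(* Under either alternative one [M] bounds [p], and bounds [r] where [a] is nonzero. Under (i), [p]
   inherits the bound from p <= r. *)
have [M HM] : exists M, {ae mu, forall x, Omega x ->
    0 <= a x /\ 1 <= p x <= r x -> p x <= M /\ (a x != 0 -> r x <= M)}.
  case: Hi => [/ess_sup_on_lty[M _ HM]|[_ /ess_sup_on_lty[P _ HP] /ess_sup_on_lty[M _ HM]]].
    exists M; apply: filterS HM => x rM Ox [_ /andP[_ pr]].
    by split=> [|_]; [exact: le_trans pr (rM Ox)|exact: rM].
  exists (Num.max P M); apply: filterS2 HP HM => x pP rM Ox _.
  split=> [|ax]; first by rewrite le_max pP.
  by rewrite le_max rM ?orbT.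
(* All exceptional points are collected in one measurable null set [N]. *)
have [N [mN N0 subN]] : {ae mu, forall x, Omega x ->
    [/\ 0 <= a x <= A, 1 <= p x <= M, 1 <= r x & a x != 0 -> r x <= M]}.
  apply: filterS3 Hpr HA HM => x H1 H2 H3 Ox.
  have [a0 /andP[p1 pr]] := H1 Ox.
  have [pM rM] := H3 Ox (H1 Ox).
  split => //.
  - by rewrite a0 (le_trans (ler_norm _) (H2 Ox)).
  - by rewrite p1.
  - exact: le_trans pr.
have mO := open_measurable_rV oO.
have Ng x : (Omega `\` N) x ->
    [/\ 0 <= a x <= A, 1 <= p x <= M, 1 <= r x & a x != 0 -> r x <= M].
  by move=> [Ox nN]; apply: contrapT => nH; apply: nN; apply: subN => /= /(_ Ox).
have mS (u : 'rV[R]_d -> R) : measurable_fun Omega u -> measurable_fun (Omega `\` N) u.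
  by apply: measurable_funS => //; exact: subDsetl.
have Hg : growth_conditions (Omega `\` N) (double_phase a p r).
  apply: double_phase_growth A0 Ng; [exact: measurableD|exact: mS..].
have CcMO := Cc_infty_MO_space oO ma mp mr mN N0 Hg.
split=> // f [mf [l l0 If]] e e0.
(* The norm is an infimum of admissible scales; admissibility of [e / 2] makes it strictly less than
   [e]. *)
have e2 : 0 < e / 2 by rewrite divr_gt0.
have mlf : cmeasurable_fun Omega (fun x => l%:C%C * f x).
  exact: cmeasurable_scale.
rewrite (MO_modularE oO ma mp mr mN N0 mlf) in If.
have [g Cg Ig] := complex_test_function_approx oO (@subDsetl _ _ _) Hg mf
  (lt0r_neq0 l0) e2 If.
exists g => //.
have mg : cmeasurable_fun Omega g by have [] := CcMO _ Cg.
have mfg : cmeasurable_fun Omega (fun x => (f x - g x) / (e / 2)%:C%C).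
  under eq_fun do rewrite mulrC -fmorphV.
  by apply: cmeasurable_scale; exact: cmeasurable_sub.
apply: (@le_lt_trans _ _ (e / 2)%:E); last by rewrite lte_fin ltr_pdivrMr// ltr_pMr// ltr1n.
apply: ereal_inf_lbound; exists (e / 2); [split; first by []|by []].
by rewrite (MO_modularE oO ma mp mr mN N0 mfg).
Qed.
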